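(* For fixed integers $k$ and $d$ satisfying $0 \le k \le d-1$, let $m_k(d)$ denote the largest integer $m$ such that the graph $\mathcal{G}_k(P)$ is $m$-connected for all convex polytopes $P$ of dimension $d$. Then \[ m_k(d) = \begin{cases} d, & \text{if } k = d-2,\\ (k+1)(d-k), & \text{otherwise.}\end{cases} \]
   Context: A convex polytope is the convex hull of a finite set of points in $\mathbb{R}^N$; its dimension is that of its affine hull, and its faces are the usual faces. For a convex polytope $P$ and a nonnegative integer $k$, $\mathcal{G}_k(P)$ denotes the simple graph whose nodes are the $k$-dimensional faces of $P$, two such faces being adjacent if there exists a $(k+1)$-dimensional face of $P$ containing them both. For a positive integer $m$, a graph $\mathcal{G}$ is $m$-connected if it has at least $m+1$ nodes and the graph obtained from $\mathcal{G}$ by deleting any set of at most $m-1$ nodes (and their incident edges) is connected. *)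

(* Defs.v *)
From HB Require Import structures.
From mathcomp Require Import all_boot all_order all_algebra.
From mathcomp Require Import classical_sets reals.
Set Implicit Arguments. Unset Strict Implicit. Unset Printing Implicit Defensive.
Import Order.TTheory GRing.Theory Num.Theory.
Local Open Scope ring_scope.

Definition dotv (R : realType) (N : nat) (x y : 'rV[R]_N) : R :=
  \sum_(i < N) x 0 i * y 0 i.

Definition conv (R : realType) (N n : nat) (V : 'I_n -> 'rV[R]_N) : set 'rV[R]_N :=
  fun x => exists w : 'I_n -> R,
    (forall i, 0 <= w i) /\ \sum_(i < n) w i = 1 /\ x = \sum_(i < n) w i *: V i.

Definition polytope (R : realType) (N : nat) (P : set 'rV[R]_N) : Prop :=
  exists (n : nat) (V : 'I_n -> 'rV[R]_N), P = conv V.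

(* affdim S d : S is nonempty and its affine hull has dimension d, i.e.
   aff S = p0 + rowspace B for some p0 in S and a d x N matrix B with
   linearly independent rows whose translates p0 + row i B lie in S. *)
Definition affdim (R : realType) (N : nat) (S : set 'rV[R]_N) (d : nat) : Prop :=
  exists p0 : 'rV[R]_N, S p0 /\
  exists B : 'M[R]_(d, N),
    row_free B /\ (forall i, S (p0 + row i B)) /\
    (forall x, S x -> (x - p0 <= B)%MS).

(* F is a face of P: F = P /\ {x | <c,x> = b} for a valid inequality
   <c,x> <= b of P (c = 0 gives P itself and the empty face). *)
Definition face (R : realType) (N : nat) (P F : set 'rV[R]_N) : Prop :=
  exists (c : 'rV[R]_N) (b : R),
    (forall x, P x -> dotv c x <= b) /\
    F = (fun x => P x /\ dotv c x = b).

Definition kface (R : realType) (N : nat) (P : set 'rV[R]_N) (k : nat)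
  (F : set 'rV[R]_N) : Prop := face P F /\ affdim F k.

Definition kadj (R : realType) (N : nat) (P : set 'rV[R]_N) (k : nat)
  (F G : set 'rV[R]_N) : Prop :=
  kface P k F /\ kface P k G /\ F <> G /\
  exists H, kface P k.+1 H /\ (forall x, F x -> H x) /\ (forall x, G x -> H x).

Definition m_connected (T : Type) (V : T -> Prop) (E : T -> T -> Prop) (m : nat) : Prop :=
  (exists f : 'I_m.+1 -> T, injective f /\ forall i, V (f i)) /\
  forall (j : nat) (s : 'I_j -> T), (j <= m - 1)%N ->
    forall u v, V u -> V v -> (forall l, s l <> u) -> (forall l, s l <> v) ->
    exists (n : nat) (p : nat -> T),
      p 0%N = u /\ p n = v /\
      (forall i, (i <= n)%N -> V (p i) /\ forall l, s l <> p i) /\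
      (forall i, (i < n)%N -> E (p i) (p i.+1)).

Definition all_Gk_connected (R : realType) (k d m : nat) : Prop :=
  forall (N : nat) (P : set 'rV[R]_N), polytope P -> affdim P d ->
    m_connected (kface P k) (kadj P k) m.

(* Main.v *)
Require Import Defs.
From mathcomp Require Import classical_sets reals boolp.
From mathcomp Require Import all_boot all_order all_algebra.
From mathcomp Require Import zify ring lra.

(**
Faces are graded by rank = dimension + 1, and an interval [S, T] of the face
lattice is treated like a polytope of rank n = rk T - rk S.  For the lower bound,
let at most i (n - i) - 1 elements X of rank i be deleted (n - 2 if i = n - 2),
and induct on i, the case i = 1 being Balinski's theorem.  If so many deleted
elements contain one atom v that the induction hypothesis fails in [v, T], then
at most n - i - 1 of them miss v, and a direct argument connects the elements
that miss v.  Otherwise, for every atom, the remaining elements above it are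
connected to each other; if the elements above the two ends of an edge were
separated, then at least C(n - 1, i - 1) > (i - 1) (n - i) deleted elements would
contain one of these ends, and the few others could not separate the remaining
atoms.  The upper bound comes from the neighbours of one face of a simplex, and,
for k = d - 2, from a bipyramid over a simplex, where the d ridges in the base
separate the two apices.
*)

Set Implicit Arguments.
Unset Strict Implicit.
Unset Printing Implicit Defensive.

(** * Face lattices *)

(** The abstract record lets the induction pass to a vertex figure without constructing one: the
    interval [[v, T]] lives in the same lattice, with ranks read off in place. Its axioms are not
    self-dual, so facts about coatoms need arguments of their own. The bounds on the elements that
    miss an atom [v] come from comparing two allowances. Going from [[S, T]] to [[v, T]] lowers [n]
    and [i] by one each, hence [i * (n - i)] by [n - i]; whatever exceeds the smaller allowance
    above [v] leaves fewer than [n - i] deletions elsewhere. For [i = n - 2] the allowance only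
    drops from [n - 1] to [n - 2], so nothing that misses [v] is deleted. The binomial
    [C(n - 1, i - 1)] is a Pascal sum: [C(n - 2, i - 2)] deleted elements above the edge and
    [C(n - 2, i - 1)] above exactly one of its ends. Polytopes enter through the cone over them, in
    which the empty face has rank 0. *)

Record face_lattice := FaceLattice {
  carrier :> finType;
  le : rel carrier;
  meet : carrier -> carrier -> carrier;
  rk : carrier -> nat;
  le_refl : reflexive le;
  le_trans : transitive le;
  meet_lel : forall x y, le (meet x y) x;
  meet_ler : forall x y, le (meet x y) y;
  le_meet : forall z x y, le z x -> le z y -> le z (meet x y);
  rk_lt : forall x y, le x y -> x != y -> rk x < rk y;
  between : forall x y, le x y -> (rk x).+1 < rk y ->
    exists z, [/\ le x z, le z y, z != x & z != y];
  relcompl : forall x a y, le x a -> le a y -> x != a -> a != y ->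
    exists b, [/\ le x b, le b y, x != b, b != y & meet a b = x];
  diamond : forall x y a b c, rk y = (rk x).+2 ->
    le x a -> le a y -> rk a = (rk x).+1 ->
    le x b -> le b y -> rk b = (rk x).+1 ->
    le x c -> le c y -> rk c = (rk x).+1 ->
    [|| a == b, a == c | b == c];
  (* the combinatorial content of the simplex method: in a polytope, a face
     that does not lie in [Y] climbs to the top of a functional vanishing on [Y] *)
  face_chain : forall S Y T A B, le S Y -> le Y T -> S != Y -> Y != T ->
    le S A -> le A T -> A != T -> ~~ le A Y ->
    le S B -> le B T -> B != T -> ~~ le B Y ->
    connect (fun C D => [&& le S C, le C T, C != T, le S D, le D T, D != T
                          & ~~ le (meet C D) Y]) A B
}.

(** * Paths, counting and binomial coefficients *)

Lemma connect_ind (T : finType) (e : rel T) (P : T -> Prop) x y :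
  connect e x y -> (forall u v, P u -> e u v -> P v) -> P x -> P y.
Proof.
move=> /connectP[p + ->] step; elim: p x => //= z p IHp x /andP[exz pz] Px.
by apply: IHp pz _; apply: step exz.
Qed.

Ltac nat_lia := repeat match goal with
  | H : ?P |- _ => lazymatch type of P with Prop =>
      lazymatch P with
      | is_true (leq _ _) => fail
      | is_true (leq _ _ && leq _ _) => fail
      | @eq ?A _ _ => lazymatch eval hnf in A with nat => fail | _ => clear H end
      | ~ @eq ?A _ _ => lazymatch eval hnf in A with nat => fail | _ => clear H end
      | is_true (?x == ?y) => lazymatch type of x with nat => fail | _ => clear H end
      | is_true (?x != ?y) => lazymatch type of x with nat => fail | _ => clear H end
      | _ => clear H
      end end
  end; lia.

Lemma leq_cardD (T : finType) (A B C : {pred T}) : {subset A <= C} ->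
  {subset B <= C} -> (forall x, x \in A -> x \in B -> False) ->
  #|A| + #|B| <= #|C|.
Proof.
move=> AC BC AB; rewrite -cardUI [X in _ + X]eq_card0 => [|x]; last first.
  by apply/negP=> /andP[/AB xA /xA].
by rewrite addn0; apply/subset_leq_card/subsetP=> x /orP[/AC|/BC].
Qed.

(** This compares the number of allowed deletions with the size of a rank level, so that some
    element always survives. *)
Lemma bin_gt_mul n i : i <= n -> i * (n - i) < 'C(n, i).
Proof.
elim: n i => [|n IHn] [|i]; rewrite ?bin0 ?mul0n // ltnS subSS binS => le_in.
have IHi := IHn _ le_in; have [lt_in|] := ltnP i n; last first.
  by move=> le_ni; rewrite (_ : n - i = 0) ?muln0 ?addn_gt0; lia.
have IHSi := IHn _ lt_in; nia.
Qed.

Lemma exists_notin (T : finType) (A : {pred T}) (B : {set T}) :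
  #|B| < #|A| -> exists2 x, x \in A & x \notin B.
Proof.
move=> ltBA; apply/exists_inP; apply: contraLR ltBA.
rewrite negb_exists_in -leqNgt => /forall_inP AB.
by apply/subset_leq_card/subsetP=> x /AB; rewrite negbK.
Qed.

(* With [n = d + 1] and [i = k + 1] this is the connectivity of the k-faces. *)
Definition face_conn n i := if i.+2 == n then n.-1 else i * (n - i).

Lemma face_conn_le n i : 0 < i -> i < n -> face_conn n i <= i * (n - i).
Proof. by rewrite /face_conn; case: eqP => // <-; nia. Qed.

Section Intervals.
Variable L : face_lattice.
Implicit Types (x y z a b c p q s t u v w A B C D E F G H J S T U : L).
Implicit Types (P Q : pred L) (X Z : {set L}).
Local Notation "x <<= y" := (le x y) (at level 70).

Lemma le_rk x y : x <<= y -> rk x <= rk y.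
Proof. by case: (eqVneq x y) => [-> //|nxy] /rk_lt/(_ nxy)/ltnW. Qed.

Lemma le_rk_eq x y : x <<= y -> rk y <= rk x -> x = y.
Proof. by move=> xy; case: (eqVneq x y) => // /(rk_lt xy); nat_lia. Qed.

Lemma le_anti x y : x <<= y -> y <<= x -> x = y.
Proof. by move=> xy /le_rk; apply: le_rk_eq. Qed.

Lemma exists_rk r x y : x <<= y -> rk x <= r <= rk y ->
  exists z, [/\ x <<= z, z <<= y & rk z = r].
Proof.
have [n] := ubnP (rk y - rk x); elim: n x y => // n IHn x y le_n xy /andP[xr ry].
have [rx|nrx] := eqVneq r (rk x); first by exists x; rewrite le_refl xy.
have [ryE|nry] := eqVneq r (rk y); first by exists y; rewrite le_refl xy.
have [||z [xz zy nzx nzy]] := @between L x y; [by []|nat_lia|].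
have zy' := rk_lt zy nzy; have xz' : rk x < rk z by rewrite rk_lt // eq_sym.
have [rz|zr] := leqP r (rk z).
  case: (IHn x z) => [|//||t [xt tz tr]]; [nat_lia|nat_lia|].
  by exists t; split=> //; apply: le_trans zy.
case: (IHn z y) => [|//||t [zt ty tr]]; [nat_lia|nat_lia|].
by exists t; split=> //; apply: le_trans zt.
Qed.

(** An upper bound of least rank is the least one, since its meet with any other upper bound is
    again an upper bound. The common bound [T] ensures that there is one. *)
Lemma join_exists x y T : x <<= T -> y <<= T ->
  exists2 j, [/\ x <<= j, y <<= j & j <<= T] &
    forall z, x <<= z -> y <<= z -> j <<= z.
Proof.
move=> xT yT; pose ub := [pred z | (x <<= z) && (y <<= z)].
have ubT : ub T by rewrite /= xT.
case: (arg_minnP (@rk L) ubT) => j /andP[xj yj] jmin.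
have lub z : x <<= z -> y <<= z -> j <<= z.
  move=> xz yz; have/jmin : ub (meet j z) by rewrite /= !le_meet.
  by move/(le_rk_eq (meet_lel j z)) <-; apply: meet_ler.
by exists j => //; split=> //; apply: lub.
Qed.

(** * Rank levels, atoms and coatoms of an interval *)

(** The rank [r] is absolute, not relative to [S], so an element keeps its level number when the
    interval changes. *)
Definition lev S T r x := [&& S <<= x, x <<= T & rk x == r].

Lemma levP S T r x : reflect [/\ S <<= x, x <<= T & rk x = r] (lev S T r x).
Proof.
by apply: (iffP and3P) => -[? ? /eqP ?].
Qed.

(** A relative complement of [a] meets it only in [S], so any atom under that complement will do. *)
Lemma atom_avoid S T a : S <<= a -> a <<= T -> a != T ->
  exists2 v, lev S T (rk S).+1 v & ~~ (v <<= a).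
Proof.
move=> Sa aT naT; have rT := rk_lt aT naT; have rS := le_rk Sa.
have [Sa'|nSa] := eqVneq S a.
  have [||v [Sv vT rv]] := @exists_rk (rk S).+1 S T; [exact: le_trans aT|nat_lia|].
  exists v; first by apply/levP.
  by apply/negP => /le_rk; rewrite -Sa'; nat_lia.
have [b [Sb bT nSb nbT abS]] := relcompl Sa aT nSa naT.
have rb := rk_lt Sb nSb.
have [||v [Sv vb rv]] := @exists_rk (rk S).+1 S b; [by []|nat_lia|].
exists v; first by apply/levP; split=> //; apply: le_trans bT.
by apply/negP=> /le_meet/(_ vb); rewrite abS => /le_rk; nat_lia.
Qed.

(** Take [b] of maximal rank among the elements not above [a]. Everything strictly above [b] is then
    above [a]; if [b] were not a coatom, two such elements with meet [b] would put [b] above [a]. *)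
Lemma coatom_avoid S T a : S <<= a -> a <<= T -> S != a ->
  exists2 c, lev S T (rk T).-1 c & ~~ (a <<= c).
Proof.
move=> Sa aT nSa; have rS := rk_lt Sa nSa; have rT := le_rk aT.
have [aT'|naT] := eqVneq a T.
  have [||c [Sc cT rc]] := @exists_rk (rk T).-1 S T; [exact: le_trans aT|nat_lia|].
  exists c; first by apply/levP.
  by apply/negP => /le_rk; rewrite aT'; nat_lia.
pose good := [pred b | [&& S <<= b, b <<= T & ~~ (a <<= b)]].
have goodS : good S.
  rewrite /= le_refl (le_trans Sa aT) /=; apply/negP=> /(le_anti Sa) aS.
  by rewrite aS eqxx in nSa.
case: (arg_maxnP (@rk L) goodS) => b /and3P[Sb bT nab] bmax.
exists b => //; apply/levP; split=> //.
have nbT : b != T by apply: contraNneq nab => ->.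
have rb := rk_lt bT nbT.
apply/eqP; rewrite -eqSS prednK; last by nat_lia.
rewrite eqn_leq rb leqNgt; apply/negP => gap.
have [z [bz zT nzb nzT]] := between bT gap.
have nbz : b != z by rewrite eq_sym.
have [b' [bb' b'T nbb' nb'T mE]] := relcompl bz zT nbz nzT.
have above t : b <<= t -> t <<= T -> b != t -> a <<= t.
  move=> bt tT nbt; apply: contraT => nat.
  have/bmax le_tb : good t by rewrite /= (le_trans Sb bt) tT.
  by have := rk_lt bt nbt; rewrite ltnNge (le_tb : rk t <= rk b).
by case/negP: nab; rewrite -mE; apply: le_meet; apply: above.
Qed.

(** [P] filters the nodes and [Q] the elements of rank [r.+1] that link them; a nontrivial [Q]
    serves for deleting edges between atoms. *)
Definition adj S T r P Q x y :=
  [&& lev S T r x, P x, lev S T r y, P y &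
    [exists h, [&& lev S T r.+1 h, Q h, x <<= h & y <<= h]]].

Lemma adj1 S T r P Q x y h : lev S T r x -> P x -> lev S T r y -> P y ->
  lev S T r.+1 h -> Q h -> x <<= h -> y <<= h -> connect (adj S T r P Q) x y.
Proof.
move=> *; apply: connect1; apply/and5P; split=> //.
by apply/existsP; exists h; apply/and4P.
Qed.

Lemma adj_sym S T r P Q : connect_sym (adj S T r P Q).
Proof.
have imp x y : adj S T r P Q x y -> adj S T r P Q y x.
  rewrite /adj.
  case/and5P=> -> -> -> -> /existsP[h /and4P[lh Qh xh yh]] /=.
  by apply/existsP; exists h; apply/and4P.
by apply: sym_connect_sym => x y; apply/idP/idP; apply: imp.
Qed.

Lemma lev_sub S T S' T' r x : S <<= S' -> T' <<= T ->
  lev S' T' r x -> lev S T r x.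
Proof.
move=> SS' T'T /levP[S'x xT' rx]; apply/levP; split=> //.
  exact: le_trans S'x. exact: le_trans T'T.
Qed.

Lemma adj_sub S T S' T' r P Q P' Q' x y : S <<= S' -> T' <<= T ->
  (forall z, lev S' T' r z -> P' z -> P z) ->
  (forall z, lev S' T' r.+1 z -> Q' z -> Q z) ->
  connect (adj S' T' r P' Q') x y -> connect (adj S T r P Q) x y.
Proof.
move=> SS' T'T PP QQ; apply: connect_sub => {}x {}y.
move=> /and5P[lx Px ly Py /existsP[h /and4P[lh Qh xh yh]]].
have sub := lev_sub SS' T'T; apply: (adj1 (h := h)) => //.
- exact: sub lx.
- exact: PP lx Px.
- exact: sub ly.
- exact: PP ly Py.
- exact: sub lh.
- exact: QQ lh Qh.
Qed.

Lemma lev_le_eq S T r x y : lev S T r x -> lev S T r y -> x <<= y -> x = y.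
Proof. by move=> /levP[_ _ rx] /levP[_ _ ry] /le_rk_eq -> //; rewrite rx ry. Qed.

(** * Connectivity of atoms and coatoms *)

Lemma atom_not_le S T v : lev S T (rk S).+1 v -> ~~ (v <<= S).
Proof. by move=> /levP[_ _ rv]; apply/negP=> /le_rk; rewrite rv ltnn. Qed.

(** [face_chain] joins [v] and [w] by proper faces of [T], consecutive ones sharing an atom off [Y];
    inside each face the induction on the rank of [T] connects its atoms off [Y]. *)
Lemma atoms_connected S T Y v w : S <<= Y -> Y <<= T -> Y != T ->
  lev S T (rk S).+1 v -> ~~ (v <<= Y) -> lev S T (rk S).+1 w -> ~~ (w <<= Y) ->
  connect (adj S T (rk S).+1 (fun z => ~~ (z <<= Y)) xpredT) v w.
Proof.
have [n] := ubnP (rk T - rk S); elim: n T Y v w => // n IHn T Y v w ltn.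
move=> SY YT nYT lv nv lw nw.
have [<-|nvw] := eqVneq v w; first exact: connect0.
have /levP[Sv vT rv] := lv; have /levP[Sw wT rw] := lw.
have [rT|gap] := leqP (rk T) (rk S).+2.
  have rTE : rk T = (rk S).+2.
    have nvT : v != T.
      apply: contraNneq nvw => vE; rewrite -vE in wT.
      by rewrite (le_rk_eq wT) // rv rw.
    by have := rk_lt vT nvT; rewrite rv; nat_lia.
  apply: (adj1 (h := T)) => //; apply/levP; split=> //.
    exact: le_trans YT. exact: le_refl.
have ltT z : rk z = (rk S).+1 -> z != T.
  by move=> rz; apply/eqP => zT; rewrite -zT rz in gap; nat_lia.
have main U : S != U -> S <<= U -> U <<= T -> U != T ->
    ~~ (v <<= U) -> ~~ (w <<= U) ->
    connect (adj S T (rk S).+1 (fun z => ~~ (z <<= U)) xpredT) v w.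
  move=> nSZ SZ ZT nZT nvZ nwZ.
  have := face_chain SZ ZT nSZ nZT Sv vT (ltT _ rv) nvZ Sw wT (ltT _ rw) nwZ.
  pose R := connect (adj S T (rk S).+1 (fun z => ~~ (z <<= U)) xpredT).
  pose good C := forall z, lev S C (rk S).+1 z -> ~~ (z <<= U) -> R v z.
  move=> ch; suff : good w by apply=> //; apply/levP; split=> //; exact: le_refl.
  apply: (connect_ind (P := good) ch) => [C D gC|]; last first.
    move=> z /levP[_ zv rz] _; rewrite (le_rk_eq zv) ?rv ?rz //.
    exact: connect0.
  case/and5P=> SC CT nCT SD /and3P[DT nDT nCD] z lz nz.
  have SM : S <<= meet C D by apply: le_meet.
  have [|||t lt nt] := @atom_avoid S (meet C D) (meet U (meet C D)).
  - exact: le_meet.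
  - exact: meet_ler.
  - by apply: contraNneq nCD => <-; apply: meet_lel.
  have ntZ : ~~ (t <<= U).
    by apply: contra nt => tZ; have /levP[? ? ?] := lt; apply: le_meet.
  apply: connect_trans (gC t _ ntZ) _.
    by apply: lev_sub lt; [exact: le_refl|exact: meet_lel].
  have ltD : lev S D (rk S).+1 t.
    by apply: lev_sub lt; [exact: le_refl|exact: meet_ler].
  have nZ' u : lev S D (rk S).+1 u -> ~~ (u <<= U) -> ~~ (u <<= meet U D).
    by move=> _; apply: contra => /le_trans; apply; apply: meet_lel.
  apply: (@adj_sub S T S D) (IHn D (meet U D) t z _ _ _ _ ltD _ lz _) => //.
  - exact: le_refl.
  - move=> u /levP[_ uD _]; apply: contra => uZ; exact: le_meet.
  - by have := rk_lt DT nDT; nat_lia.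
  - exact: le_meet.
  - exact: meet_ler.
  - by apply: contraNneq nCD => mE; apply: le_trans (meet_lel U D); rewrite mE meet_ler.
  - exact: nZ' ltD ntZ.
  - exact: nZ' lz nz.
have [SYE|nSY] := eqVneq S Y; last exact: main.
(* Now nothing has to be avoided, but [face_chain] wants [Y] strictly above [S]. The second end [u]
   of an edge through [v] is avoided instead; if it happens to be [w], that edge already links the
   two. *)
subst Y.
have [||e [ve eT re]] := @exists_rk (rk S).+2 v T; [by []|nat_lia|].
have nve : v != e by apply: contra_eq_neq rv => ->; rewrite re; nat_lia.
have [u lu nuv] := atom_avoid Sv ve nve.
have le_e : lev S T (rk S).+2 e by apply/levP; split=> //; apply: le_trans ve.
have [uw|nuw] := eqVneq u w.
  apply: (adj1 (h := e)) => //.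
  by have /levP[_ ue _] := lu; rewrite -uw.
have lu' : lev S T (rk S).+1 u by apply: lev_sub lu; rewrite ?le_refl.
have /levP[Su uT ru] := lu'.
apply: (adj_sub (le_refl S) (le_refl T)) (main u _ Su uT (ltT _ ru) _ _) => //.
- by move=> z /atom_not_le.
- by apply: contra_eq_neq ru => <-; nat_lia.
- by apply: contra nuv => /(lev_le_eq lv lu') <-; apply: le_refl.
- by apply: contra nuw => /(lev_le_eq lw lu') ->.
Qed.

(** Pascal's rule: the elements above an atom [v] and those below a coatom missing [v] are disjoint
    families. *)
Lemma bin_le_card_lev S T r : S <<= T -> rk S <= r ->
  'C(rk T - rk S, r - rk S) <= #|lev S T r|.
Proof.
have [n] := ubnP (rk T - rk S); elim: n S T => // n IHn S T ltn ST Sr.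
have rST := le_rk ST.
have [rT|Tr] := ltnP (rk T) r; first by rewrite bin_small //; nat_lia.
have [rS|nrS] := eqVneq r (rk S).
  rewrite rS subnn bin0; apply/card_gt0P; exists S; apply/levP.
  by split=> //; apply: le_refl.
have [||v [Sv vT rv]] := @exists_rk (rk S).+1 S T; [by []|nat_lia|].
have nSv : S != v by apply: contra_eq_neq rv => <-; nat_lia.
have [F /levP[SF FT rF] nvF] := coatom_avoid Sv vT nSv.
have IHv := IHn v T _ vT; have IHF := IHn S F _ SF.
have -> : 'C(rk T - rk S, r - rk S) =
    'C(rk T - rk v, r - rk v) + 'C(rk F - rk S, r - rk S).
  rewrite rv rF; have -> : rk T - rk S = (rk T - (rk S).+1).+1 by nat_lia.
  have -> : r - rk S = (r - (rk S).+1).+1 by nat_lia.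
  have -> : (rk T).-1 - rk S = rk T - (rk S).+1 by nat_lia.
  by rewrite binS addnC.
apply: leq_trans (leq_add (IHv _ _) (IHF _ _)) _; try nat_lia.
apply: leq_cardD => [x|x|x] /levP[h1 h2 h3].
- by apply/levP; split=> //; apply: le_trans h1.
- by apply/levP; split=> //; apply: le_trans FT.
- by move=> /levP[_ xF _]; case/negP: nvF; apply: le_trans xF.
Qed.

Lemma card_lev_gt S T r : S <<= T -> rk S <= r <= rk T ->
  (r - rk S) * (rk T - r) < #|lev S T r|.
Proof.
move=> ST /andP[Sr rT]; apply: leq_trans (bin_le_card_lev ST Sr).
have -> : rk T - r = rk T - rk S - (r - rk S) by nat_lia.
by apply: bin_gt_mul; nat_lia.
Qed.

Lemma card_atoms S T : S <<= T -> rk S < rk T ->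
  rk T - rk S <= #|lev S T (rk S).+1|.
Proof.
by move=> ST gt; have := @card_lev_gt S T (rk S).+1 ST; rewrite leqnSn gt; nat_lia.
Qed.

Definition coadj S T Y F G :=
  [&& lev S T (rk T).-1 F, ~~ (Y <<= F), lev S T (rk T).-1 G, ~~ (Y <<= G) &
    [exists h, [&& lev S T (rk T).-2 h, h <<= F & h <<= G]]].

(** Two coatoms over a common atom [u] are joined by induction in [[u, T]], with [Y] replaced by its
    join with [u]. In general, move along a path of atoms that avoids one atom [y] of [Y]: by the
    diamond property no edge [h] of this path contains [y], so some coatom above [h] is not above
    [Y] and is shared by both ends. *)
Lemma coatoms_connected S T Y F G : S <<= Y -> Y <<= T -> S != Y ->
  lev S T (rk T).-1 F -> ~~ (Y <<= F) -> lev S T (rk T).-1 G -> ~~ (Y <<= G) ->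
  connect (coadj S T Y) F G.
Proof.
have [n] := ubnP (rk T - rk S); elim: n S Y F G => // n IHn S Y F G ltn.
move=> SY YT nSY lF nF lG nG.
have /levP[SF FT rF] := lF; have /levP[SG GT rG] := lG.
have rST := rk_lt SY nSY; have rYT := le_rk YT.
have [gap|gap] := leqP (rk T) (rk S).+2.
  have [rT|rT] : rk T = (rk S).+1 \/ rk T = (rk S).+2 by nat_lia.
    have <- : S = F by apply: le_rk_eq => //; nat_lia.
    have <- : S = G by apply: le_rk_eq => //; nat_lia.
    exact: connect0.
  apply: connect1; apply/and5P; split=> //; apply/existsP; exists S.
  rewrite SF SG andbT andbT; apply/levP; split; rewrite ?le_refl ?rT //.
  exact: le_trans YT.
have share u F' G' : lev S T (rk S).+1 u -> u <<= F' -> u <<= G' ->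
    lev S T (rk T).-1 F' -> ~~ (Y <<= F') ->
    lev S T (rk T).-1 G' -> ~~ (Y <<= G') -> connect (coadj S T Y) F' G'.
  move=> /levP[Su uT ru] uF uG /levP[SF' FT' rF'] nF' /levP[SG' GT' rG'] nG'.
  have [J [uJ YJ JT] lub] := join_exists uT YT.
  have nuJ : u != J.
    by apply: contraNneq nF' => uE; apply: le_trans uF; rewrite uE.
  apply: (connect_sub _ (IHn u J F' G' _ uJ JT nuJ _ _ _ _)); last first.
  - by apply: contra nG'; apply: le_trans.
  - exact/levP.
  - by apply: contra nF'; apply: le_trans.
  - exact/levP.
  - by nat_lia.
  move=> C D /and5P[lC nC lD nD /existsP[h /and3P[lh hC hD]]].
  apply: connect1; apply/and5P; split.
  - exact: lev_sub Su (le_refl T) lC.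
  - by apply: contra nC; apply: lub; case/levP: lC.
  - exact: lev_sub Su (le_refl T) lD.
  - by apply: contra nD; apply: lub; case/levP: lD.
  - apply/existsP; exists h; apply/and3P; split=> //.
    exact: lev_sub Su (le_refl T) lh.
have [||y [Sy yY ry]] := @exists_rk (rk S).+1 S Y; [by []|nat_lia|].
have yT := le_trans yY YT.
have nyT : y != T by apply: contra_eq_neq ry => ->; nat_lia.
have atom C : lev S T (rk T).-1 C ->
    exists2 u, lev S T (rk S).+1 u & u <<= C /\ ~~ (u <<= y).
  move=> /levP[SC CT rC].
  have [|||u lu nu] := @atom_avoid S C (meet y C).
  - exact: le_meet.
  - exact: meet_ler.
  - apply/eqP=> mE; have := le_rk (meet_lel y C); rewrite mE; nat_lia.
  have /levP[Su uC _] := lu.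
  exists u; first by apply: lev_sub lu; rewrite ?le_refl.
  by split=> //; apply: contra nu => uy; apply: le_meet.
have [u lu [uF nuy]] := atom F lF; have [v lv [vG nvy]] := atom G lG.
have ch := atoms_connected Sy yT nyT lu nuy lv nvy.
pose good z := lev S T (rk S).+1 z /\ forall C, lev S T (rk T).-1 C ->
  ~~ (Y <<= C) -> z <<= C -> connect (coadj S T Y) F C.
suff [_] : good v by apply.
apply: (connect_ind (P := good) ch) => [p q [lp gp]|]; last first.
  by split=> // C lC nC uC; apply: share lu uF uC lF nF lC nC.
move=> /and5P[_ np lq nq /existsP[h /and4P[lh _ ph qh]]].
split=> // C lC nC qC.
have [pq|npq] := eqVneq p q; first by apply: gp; rewrite ?pq.
have /levP[Sh hT rh] := lh; have /levP[Sp pT rp] := lp; have /levP[Sq qT rq] := lq.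
have nYh : ~~ (Y <<= h).
  apply/negP=> Yh; have yh := le_trans yY Yh.
  have := diamond rh Sp ph rp Sq qh rq Sy yh ry.
  rewrite (negbTE npq) /=; case/orP=> /eqP.
    by move=> pE; rewrite pE le_refl in np.
  by move=> qE; rewrite qE le_refl in nq.
have [J [hJ YJ JT] lub] := join_exists hT YT.
have nhJ : h != J by apply: contraNneq nYh => ->.
have [c lc nJc] := coatom_avoid hJ JT nhJ; have /levP[hc cT rc] := lc.
have nYc : ~~ (Y <<= c) by apply: contra nJc; apply: lub.
have lc' := lev_sub Sh (le_refl T) lc.
apply: connect_trans (gp c lc' nYc (le_trans ph hc)) _.
exact: share lq (le_trans qh hc) qC lc' nYc lC nC.
Qed.

(* Balinski's theorem. *)
Lemma atoms_connected_avoid S T X v w : S <<= T -> #|X|.+1 < rk T - rk S ->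
  lev S T (rk S).+1 v -> v \notin X -> lev S T (rk S).+1 w -> w \notin X ->
  connect (adj S T (rk S).+1 (fun z => z \notin X) xpredT) v w.
Proof.
have [n] := ubnP (rk T - rk S); elim: n T X v w => // n IHn T X v w ltn.
move=> ST Xn lv nv lw nw.
have nST : S != T by apply: contraTneq Xn => ->; nat_lia.
have [x /andP[xX lx]|noX] :=
    pickP [pred x | (x \in X) && lev S T (rk S).+1 x]; last first.
  apply: (adj_sub (le_refl S) (le_refl T)) (atoms_connected (le_refl S) ST nST
    lv (atom_not_le lv) lw (atom_not_le lw)) => // z lz _.
  by have := noX z; rewrite /= lz andbT => ->.
have X_gt0 : 0 < #|X| by apply/card_gt0P; exists x.
have XxE : #|X :\ x| = #|X|.-1 by have := cardsD1 x X; rewrite xX => ->.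
have /levP[Sx xT rx] := lx.
have nSx : S != x by apply: contra_eq_neq rx => <-; nat_lia.
(* A facet that misses the deleted atom [x] loses one rank but also at least one deleted atom, so
   the induction hypothesis applies in it. *)
have facet F p q : lev S T (rk T).-1 F -> ~~ (x <<= F) ->
    lev S F (rk S).+1 p -> p \notin X -> lev S F (rk S).+1 q -> q \notin X ->
    connect (adj S T (rk S).+1 (fun z => z \notin X) xpredT) p q.
  move=> /levP[SF FT rF] nxF lp np lq nq.
  have le_Xx : #|X :&: [set z | z <<= F]| <= #|X :\ x|.
    apply/subset_leq_card/subsetP=> z; rewrite !inE => /andP[-> zF].
    by rewrite andbT; apply: contraNneq nxF => <-.
  apply: (adj_sub (le_refl S) FT) (IHn F (X :&: [set z | z <<= F]) p q
    _ SF _ lp _ lq _) => //.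
  - by move=> z /levP[_ zF _]; rewrite !inE zF andbT.
  - by nat_lia.
  - by nat_lia.
  - by rewrite inE (negbTE np).
  - by rewrite inE (negbTE nq).
have over p : lev S T (rk S).+1 p -> p \notin X ->
    exists F, [/\ p <<= F, lev S T (rk T).-1 F & ~~ (x <<= F)].
  move=> lp np; have /levP[Sp pT rp] := lp.
  have [J [pJ xJ JT] lub] := join_exists pT xT.
  have npJ : p != J.
    apply: contraNneq np => pE; rewrite -pE in xJ.
    by rewrite -(lev_le_eq lx lp xJ).
  have [F lF nJF] := coatom_avoid pJ JT npJ; have /levP[pF FT rF] := lF.
  exists F; split=> //; first exact: lev_sub Sp (le_refl T) lF.
  by apply: contra nJF; apply: lub.
have [F [vF lF nxF]] := over v lv nv; have [G [wG lG nxG]] := over w lw nw.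
have ch := coatoms_connected Sx xT nSx lF nxF lG nxG.
have restr p C : lev S T (rk S).+1 p -> p <<= C -> lev S C (rk S).+1 p.
  by move=> /levP[Sp _ rp] pC; apply/levP.
pose good C := forall z, lev S C (rk S).+1 z -> z \notin X ->
  connect (adj S T (rk S).+1 (fun z => z \notin X) xpredT) v z.
suff : good G by apply=> //; apply: restr.
apply: (connect_ind (P := good) ch) => [C D gC|z lz nz]; last first.
  by apply: facet lF nxF _ nv lz nz; apply: restr.
move=> /and5P[lC nC lD nD /existsP[h /and3P[/levP[Sh hT rh] hC hD]]].
move=> z lz nz.
(* A ridge has at least [rk T - rk S - 2] atoms, and at most [#|X| - 1] are deleted because it
   misses [x]. *)
have [|t lt nt] := @exists_notin _ (lev S h (rk S).+1) (X :\ x).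
  by rewrite XxE; apply: leq_trans (card_atoms Sh _); nat_lia.
have ntX : t \notin X.
  rewrite !inE negb_and negbK in nt; case/orP: nt => // /eqP tx.
  by case/negP: nC; apply: le_trans hC; rewrite -tx; case/levP: lt.
apply: connect_trans (gC t (lev_sub (le_refl S) hC lt) ntX) _.
exact: facet lD nD (lev_sub (le_refl S) hD lt) ntX lz nz.
Qed.

(** A deleted edge is traded for one deleted end: without this end the edge links no two distinct
    atoms. Only paths whose ends differ from it are obtained so, hence the detour through a third
    atom [u] off the edge, with the deleted end chosen afresh on each half. *)
Lemma atoms_connected_avoid_edges S T Z X v w : S <<= T ->
  (#|Z| + #|X|).+1 < rk T - rk S ->
  lev S T (rk S).+1 v -> v \notin Z -> lev S T (rk S).+1 w -> w \notin Z ->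
  connect (adj S T (rk S).+1 (fun z => z \notin Z) (fun z => z \notin X)) v w.
Proof.
move=> ST; have [n] := ubnP #|X|; elim: n X Z v w => // n IHn X Z v w ltn.
move=> gap lv nv lw nw.
have [X0|[e eX]] := set_0Vmem X.
  subst X; apply: (adj_sub (le_refl S) (le_refl T)) (atoms_connected_avoid ST
    _ lv nv lw nw) => //.
    by move=> z _ _; rewrite inE.
  by rewrite cards0 in gap; nat_lia.
have cX : #|X| = #|X :\ e|.+1 by rewrite (cardsD1 e) eX.
have [le_e|nle_e] := boolP (lev S T (rk S).+2 e); last first.
  apply: (adj_sub (le_refl S) (le_refl T)) (IHn (X :\ e) Z v w _ _ lv nv lw nw).
  - by [].
  - move=> z lz; rewrite !inE negb_and negbK => /orP[/eqP zE|//].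
    by rewrite -zE lz in nle_e.
  - by nat_lia.
  - by nat_lia.
have /levP[Se eT re] := le_e.
have sub a p q : lev S e (rk S).+1 a -> p != a -> q != a ->
    lev S T (rk S).+1 p -> p \notin Z -> lev S T (rk S).+1 q -> q \notin Z ->
    connect (adj S T (rk S).+1 (fun z => z \notin Z) (fun z => z \notin X)) p q.
  move=> /levP[Sa ae ra] npa nqa lp np lq nq.
  have cZ : #|a |: Z| <= #|Z|.+1 by rewrite cardsU1; case: (a \notin Z).
  apply: (connect_sub _ (IHn (X :\ e) (a |: Z) p q _ _ lp _ lq _)); last first.
  - by rewrite !inE negb_or nqa.
  - by rewrite !inE negb_or npa.
  - by nat_lia.
  - by nat_lia.
  move=> s t /and5P[ls ns lt nt /existsP[h /and4P[lh nh sh th]]].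
  have [->|nst] := eqVneq s t; first exact: connect0.
  move: ns nt; rewrite !inE !negb_or => /andP[nsa ns] /andP[nta nt].
  apply: adj1 (sh) (th) => //; apply: contra nh => hX; rewrite !inE hX andbT.
  apply: contraTneq isT => he; rewrite he in sh th.
  have /levP[Ss _ rs] := ls; have /levP[St _ rt] := lt.
  have := diamond re Ss sh rs St th rt Sa ae ra.
  by rewrite (negbTE nst) (negbTE nsa) (negbTE nta).
have nSe : S != e by apply: contra_eq_neq re => <-; nat_lia.
have [p lp _] := atom_avoid (le_refl S) Se nSe.
have /levP[Sp pe rp] := lp.
have npe : p != e by apply: contra_eq_neq rp => ->; nat_lia.
have [q lq nqp] := atom_avoid Sp pe npe.
have npq : p != q by apply: contraNneq nqp => ->; apply: le_refl.
have step s t : t != p -> t != q -> lev S T (rk S).+1 s -> s \notin Z ->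
    lev S T (rk S).+1 t -> t \notin Z ->
    connect (adj S T (rk S).+1 (fun z => z \notin Z) (fun z => z \notin X)) s t.
  move=> ntp ntq; have [->|nsp] := eqVneq s p; last exact: sub lp nsp ntp.
  exact: sub lq npq ntq.
have [|u lu] := @exists_notin _ (lev S T (rk S).+1) (Z :|: [set p; q]).
  apply: leq_trans (card_atoms ST _); last by nat_lia.
  by have := (leq_card_setU Z [set p; q]).1; rewrite cards2 npq; nat_lia.
rewrite !inE !negb_or => /and3P[nuZ nup nuq].
by apply: connect_trans (step _ _ nup nuq lv nv lu nuZ) _; rewrite adj_sym step.
Qed.

(** * Elements that miss a given atom *)

Lemma cover_eq A H H' x : ~~ (x <<= A) -> A <<= H -> A <<= H' ->
  x <<= H -> x <<= H' -> rk H = (rk A).+1 -> rk H' = (rk A).+1 -> H = H'.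
Proof.
move=> nxA AH AH' xH xH' rH rH'.
have AM : A <<= meet H H' by apply: le_meet.
have nAM : A != meet H H'.
  by apply: contraNneq nxA => ->; apply: le_meet.
have rM := rk_lt AM nAM.
have <- : meet H H' = H by apply: le_rk_eq (meet_lel _ _) _; rewrite rH.
by apply: le_rk_eq (meet_ler _ _) _; rewrite rH'.
Qed.

(** By [cover_eq] an element not below [A] lies under at most one cover of [A], so [X] spoils at
    most [#|X|] covers, fewer than there are. *)
Lemma cover_avoid A T X : A <<= T -> #|X| < rk T - rk A ->
  exists2 H, lev A T (rk A).+1 H & forall x, x \in X -> x <<= H -> x <<= A.
Proof.
move=> AT Xlt; pose h x := odflt A [pick H | lev A T (rk A).+1 H && (x <<= H)].
have [|H lH nH] := @exists_notin _ (lev A T (rk A).+1) (h @: X).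
  apply: leq_trans (card_atoms AT _); last by nat_lia.
  exact: leq_ltn_trans (leq_imset_card h X) Xlt.
exists H => // x xX xH; apply: contraNT nH => nxA.
apply/imsetP; exists x => //; rewrite /h; case: pickP => [H'|/(_ H)]; last first.
  by rewrite /= xH andbT (lH : lev A T (rk A).+1 H).
have /levP[AH _ rH] := lH.
by case/andP=> /levP[AH' _ rH'] xH' /=; apply: (@cover_eq A H H' x).
Qed.

(** Induction on [r]. Elements that cover a common [E] are atoms of [[E, T]], where Balinski's
    theorem connects them unless [E] is bad; the walk is therefore made among the elements [E] one
    rank lower, with at most one of these deleted. The hypothesis for atoms leaves room for deleting
    [v] as well, and the one for [r.+2 = rk T] rules out bad elements there. *)
Lemma levels_connected_avoid_vertex S T r X v D D' :
  S <<= T -> rk S < r -> r.+2 <= rk T -> #|X| < rk T - r ->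
  (r = (rk S).+1 -> #|X|.+2 < rk T - rk S) -> (r.+2 = rk T -> #|X| = 0) ->
  lev S T (rk S).+1 v ->
  lev S T r D -> ~~ (v <<= D) -> D \notin X ->
  lev S T r D' -> ~~ (v <<= D') -> D' \notin X ->
  connect (adj S T r (fun z => ~~ (v <<= z) && (z \notin X)) xpredT) D D'.
Proof.
move=> ST; elim: r X D D' => // r IHr X D D' Sr rT cX cX1 cX2 lv lD nvD nD lD' nvD' nD'.
have /levP[Sv vT rv] := lv.
have [rS|nrS] := eqVneq r (rk S).
  have cvX : #|v |: X| <= #|X|.+1 by rewrite cardsU1; case: (_ \notin _).
  have notin C : ~~ (v <<= C) -> C \notin X -> C \notin v |: X.
    move=> nvC nC; rewrite !inE negb_or nC andbT.
    by apply: contraNneq nvC => ->; apply: le_refl.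
  rewrite rS; rewrite rS in lD lD' cX1.
  apply: (adj_sub (le_refl S) (le_refl T)) (@atoms_connected_avoid S T (v |: X)
    D D' ST _ lD _ lD' _) => //.
  - move=> z lz; rewrite !inE negb_or => /andP[nzv ->]; rewrite andbT.
    by apply: contra nzv => /(lev_le_eq lv lz) ->.
  - by have := cX1 erefl; nat_lia.
  - exact: notin.
  - exact: notin.
pose above E := X :&: [set x | lev E T r.+1 x].
(* Bad means that Balinski's theorem in [[E, T]] no longer covers the deletion of [above E] together
   with the join of [E] and [v]. Such an [E] has all of [X] above it, and two of them would share
   two covers. *)
pose bad := [set E | lev S T r E & rk T <= r.+2 + #|above E|].
have bad_le1 : #|bad| <= 1.
  rewrite leqNgt; apply/negP=> /card_gt1P[E [E' []]].
  rewrite !inE => /andP[lE bE] /andP[lE' bE'] nEE'.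
  have sub C : rk T <= r.+2 + #|above C| -> X \subset above C.
    move=> bC; have /eqP <- // : above C == X.
    by rewrite eqEcard subsetIl; nat_lia.
  have [rT3|rT3] : rk T = r.+3 \/ r.+3 < rk T by nat_lia.
    have := subset_leq_card (subsetIl X [set x | lev E T r.+1 x]).
    by rewrite -/(above E) cX2 //; nat_lia.
  have /card_gt1P[x [y [xX yX nxy]]] : 1 < #|X|.
    by have := subset_leq_card (subsetIl X [set x | lev E T r.+1 x]);
      rewrite -/(above E); nat_lia.
  have up z : z \in X -> [/\ E <<= z, E' <<= z & rk z = r.+1].
    move=> zX; have := subsetP (sub _ bE) z zX; have := subsetP (sub _ bE') z zX.
    by rewrite !inE => /andP[_ /levP[? _ _]] /andP[_ /levP[? _ ?]].
  have [Ex E'x rx] := up x xX; have [Ey E'y ry] := up y yX.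
  have /levP[_ _ rE] := lE.
  case/eqP: nxy; apply: (@cover_eq E x y E') => //; rewrite ?rE //.
  by apply: contra nEE' => /(lev_le_eq lE' lE) ->.
have within E C C' : lev S T r E -> ~~ (v <<= E) -> E \notin bad ->
    lev E T r.+1 C -> ~~ (v <<= C) -> C \notin X ->
    lev E T r.+1 C' -> ~~ (v <<= C') -> C' \notin X ->
    connect (adj S T r.+1 (fun z => ~~ (v <<= z) && (z \notin X)) xpredT) C C'.
  move=> lE nvE; rewrite inE lE -ltnNge /= => nbE lC nvC nC lC' nvC' nC'.
  have /levP[SE ET rE] := lE.
  have [J [EJ vJ JT] lub] := join_exists ET vT.
  have cJ : #|J |: above E| <= #|above E|.+1 by rewrite cardsU1; case: (_ \notin _).
  have notin B : ~~ (v <<= B) -> B \notin X -> B \notin J |: above E.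
    move=> nvB nB; rewrite !inE negb_or (negbTE nB) andbT.
    by apply: contraNneq nvB => ->.
  rewrite -rE; rewrite -rE in lC lC'.
  apply: (adj_sub SE (le_refl T)) (@atoms_connected_avoid E T (J |: above E)
    C C' ET _ lC _ lC' _) => //.
  - move=> z lz; rewrite !inE negb_or -rE lz andbT => /andP[nzJ ->]; rewrite andbT.
    have /levP[Ez zT rz] := lz.
    apply: contra nzJ => vz; rewrite eq_sym; apply/eqP.
    apply: le_rk_eq (lub _ Ez vz) _; rewrite rz; apply: rk_lt => //.
    by apply: contraNneq nvE => ->.
  - by nat_lia.
  - exact: notin.
  - exact: notin.
have under C : lev S T r.+1 C -> exists2 E, lev S T r E & E <<= C /\ E \notin bad.
  move=> /levP[SC CT rC].
  have [|E lE nE] := @exists_notin _ (lev S C r) bad.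
    apply: leq_ltn_trans bad_le1 _.
    have := @card_lev_gt S C r SC; rewrite rC subSnn muln1.
    have -> : rk S <= r <= r.+1 by nat_lia.
    by move=> /(_ isT); apply: leq_ltn_trans; nat_lia.
  have /levP[SE EC rE] := lE.
  by exists E; [exact: lev_sub (le_refl S) CT lE|].
have [E lE [ED nbE]] := under D lD; have [E' lE' [ED' nbE']] := under D' lD'.
have ch : connect (adj S T r (fun z => ~~ (v <<= z) && (z \notin bad)) xpredT)
    E E'.
  apply: IHr => //; try nat_lia.
  - by apply: contra nvD => /le_trans; apply.
  - by apply: contra nvD' => /le_trans; apply.
have top C B : lev S T r.+1 C -> B <<= C -> lev B T r.+1 C.
  by move=> /levP[_ ? ?] ?; apply/levP.
pose good B := forall C, lev B T r.+1 C -> ~~ (v <<= C) -> C \notin X ->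
    connect (adj S T r.+1 (fun z => ~~ (v <<= z) && (z \notin X)) xpredT) D C.
suff : good E' by apply=> //; apply: top.
apply: (connect_ind (P := good) ch) => [B B' gB|C lC nvC nC]; last first.
  apply: (within _ _ _ lE _ nbE (top D E lD ED) nvD nD lC nvC nC).
  by apply: contra nvD => /le_trans; apply.
case/and5P=> lB /andP[nvB nbB] lB' /andP[nvB' nbB'].
move=> /existsP[D0 /and4P[lD0 _ BD0 BD0']] C lC nvC nC.
suff [D1 [D1' [lD1 [nvD1 nD1] lD1' [nvD1' nD1'] cD1]]] : exists D1 D1',
    [/\ lev B T r.+1 D1, ~~ (v <<= D1) /\ D1 \notin X,
        lev B' T r.+1 D1', ~~ (v <<= D1') /\ D1' \notin X &
    connect (adj S T r.+1 (fun z => ~~ (v <<= z) && (z \notin X)) xpredT) D1 D1'].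
  apply: connect_trans (gB D1 lD1 nvD1 nD1) _; apply: connect_trans cD1 _.
  exact: within lB' nvB' nbB' lD1' nvD1' nD1' lC nvC nC.
have [/andP[nvD0 nD0]|bD0] := boolP (~~ (v <<= D0) && (D0 \notin X)).
  exists D0, D0; split=> //; try exact: top; exact: connect0.
have /levP[SD0 D0T rD0] := lD0.
(* The link [D0] cannot be used itself. [X'] is no larger than [X]: if [v] is not below [D0], then
   [D0] is deleted and makes room for [v]. *)
pose X' := if v <<= D0 then X else v |: (X :\ D0).
have cX' : #|X'| < rk T - rk D0.
  rewrite rD0 /X'; case: ifP => // vD0.
  move: bD0; rewrite vD0 /= negbK => D0X.
  by rewrite cardsU1; have := cardsD1 D0 X; rewrite D0X; case: (_ \notin _); nat_lia.
have [H lH avoid] := cover_avoid D0T cX'; have /levP[D0H HT rH] := lH.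
(* [D1] is an element between [A] and [H] other than [D0]. If [v] is below [D0], it is not below
   [D1], since only one cover of [A] contains [v]; all else is kept out by the choice of [H]. *)
have pickD A : lev S T r A -> ~~ (v <<= A) -> A <<= D0 ->
    exists2 D1, lev A T r.+1 D1 & [/\ ~~ (v <<= D1), D1 \notin X & D1 <<= H].
  move=> lA nvA AD0; have /levP[SA AT rA] := lA.
  have nD0H : D0 != H by apply: contra_eq_neq rH => <-; nat_lia.
  have [D1 lD1 nD1] := atom_avoid AD0 D0H nD0H.
  have /levP[AD1 D1H rD1] := lD1.
  exists D1; first by rewrite -rA; exact: lev_sub (le_refl A) HT lD1.
  split=> //.
    apply/negP=> vD1; have [vD0|nvD0] := boolP (v <<= D0); last first.
      case/negP: (nvD0); apply: avoid (le_trans vD1 D1H).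
      by rewrite /X' (negbTE nvD0) !inE eqxx.
    by case/negP: (nD1); rewrite (@cover_eq A D1 D0 v) ?le_refl // rD0 rA.
  apply: contra (nD1) => D1X; apply: avoid (D1H); rewrite /X'; case: ifP => // _.
  rewrite !inE D1X andbT orbC; case: eqVneq => // D1E; case/negP: (nD1).
  by rewrite D1E le_refl.
have [D1 lD1 [nvD1 nD1 D1H]] := pickD B lB nvB BD0.
have [D1' lD1' [nvD1' nD1' D1H']] := pickD B' lB' nvB' BD0'.
exists D1, D1'; split=> //.
have /levP[SB _ _] := lB; have /levP[SB' _ _] := lB'.
apply: (adj1 (h := H)) => //.
- exact: lev_sub SB (le_refl T) lD1.
- by rewrite nvD1.
- exact: lev_sub SB' (le_refl T) lD1'.
- by rewrite nvD1'.
- by rewrite -rD0; exact: lev_sub SD0 (le_refl T) lH.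
Qed.

(** * The two ends of an edge *)

Lemma edge_le S T e p q x : lev S T (rk S).+1 p -> lev S T (rk S).+1 q ->
  p != q -> p <<= e -> q <<= e -> rk e = (rk S).+2 ->
  p <<= x -> q <<= x -> e <<= x.
Proof.
move=> lp lq npq pe qe re px qx; have /levP[Sp _ rp] := lp.
have pM : p <<= meet e x by apply: le_meet.
have npM : p != meet e x.
  apply: contraNneq npq => pE; rewrite eq_sym; apply/eqP.
  by apply: (lev_le_eq lq lp); rewrite pE; apply: le_meet.
have := rk_lt pM npM; rewrite rp => rM.
suff <- : meet e x = e by apply: meet_ler.
by apply: le_rk_eq (meet_lel _ _) _; rewrite re.
Qed.

Lemma edge_atoms S T e p q u : lev S T (rk S).+1 p -> lev S T (rk S).+1 q ->
  lev S T (rk S).+1 u -> rk e = (rk S).+2 -> p <<= e -> q <<= e -> u <<= e ->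
  [|| p == q, p == u | q == u].
Proof.
move=> /levP[Sp _ rp] /levP[Sq _ rq] /levP[Su _ ru] re pe qe ue.
exact: (diamond re Sp pe rp Sq qe rq Su ue ru).
Qed.

(* Every face of [p, T] of rank [r.+1] above the edge [e] has a facet through
   exactly one end of [e] that lies in [X], as the two ends are separated. *)
Lemma separated_edge_card S T r X e p q : S <<= T -> (rk S).+1 < r -> r < rk T ->
  lev S T (rk S).+1 p -> lev S T (rk S).+1 q -> p != q ->
  p <<= e -> q <<= e -> e <<= T -> rk e = (rk S).+2 ->
  (forall D D', lev p T r D -> lev q T r D' -> D \notin X -> D' \notin X ->
     ~~ connect (adj S T r (fun z => z \notin X) xpredT) D D') ->
  (r - (rk S).+1) * (rk T - r) < #|[set x in X | (p <<= x) || (q <<= x)]|.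
Proof.
move=> ST Sr rT lp lq npq pe qe eT re sep.
have /levP[Sp pT rp] := lp; have /levP[Sq qT rq] := lq.
have ind D : lev p T r D -> lev S T r D by apply: lev_sub Sp (le_refl T).
have inq D : lev q T r D -> lev S T r D by apply: lev_sub Sq (le_refl T).
pose g H := odflt H [pick D | [&& D \in X, lev S T r D, D <<= H,
  ~~ (e <<= D) & (p <<= D) || (q <<= D)]].
have gP H : lev e T r.+1 H -> [/\ g H \in X, rk (g H) = r, g H <<= H,
    ~~ (e <<= g H) & (p <<= g H) || (q <<= g H)].
  move=> /levP[eH HT rH]; rewrite /g; case: pickP => [D|no].
    by case/and5P=> ? /levP[_ _ ?].
  have below a b : a <<= e -> lev S T (rk S).+1 a -> exists2 D, lev a T r D &
      D <<= H /\ ~~ (e <<= D).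
    move=> ae /levP[Sa aT ra]; have nae : a != e.
      by apply: contra_eq_neq ra => ->; rewrite re; nat_lia.
    have [D lD neD] := coatom_avoid ae eH nae.
    have /levP[aD DH rD] := lD; exists D => //.
    by rewrite rH in lD; apply: lev_sub (le_refl a) HT lD.
  have [D lD [DH neD]] := below p q pe lp.
  have [D' lD' [D'H neD']] := below q p qe lq.
  have nX C : (p <<= C) || (q <<= C) -> lev S T r C -> C <<= H ->
      ~~ (e <<= C) -> C \notin X.
    move=> pqC lC CH neC; apply/negP=> CX.
    by have := no C; rewrite /= CX lC CH neC pqC.
  have nD : D \notin X by apply: nX; [case/levP: lD => ->| exact: ind| |].
  have nD' : D' \notin X.
    by apply: nX; [case/levP: lD' => ->; rewrite orbT| exact: inq| |].
  case/negP: (sep D D' lD lD' nD nD').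
  apply: (adj1 (h := H)) => //; [exact: ind|exact: inq|].
  by apply/levP; split=> //; exact: le_trans Sp (le_trans pe eH).
(* [H] is recovered from [g H] as its only cover above [e]. *)
have g_inj : {in [set H | lev e T r.+1 H] &, injective g}.
  move=> H H'; rewrite !inE => lH lH' gE.
  have [_ rg gH ng _] := gP H lH; have [_ rg' gH' ng' _] := gP H' lH'.
  have /levP[eH _ rH] := lH; have /levP[eH' _ rH'] := lH'.
  apply: (@cover_eq (g H) H H' e) => //; rewrite ?rg //.
  by rewrite gE.
(* A surviving element above [e] would lie above both ends and connect them. *)
have leC : forall x, lev e T r x -> x \in X.
  move=> x /levP[ex xT rx]; apply: contraT => nx.
  have px := le_trans pe ex; have qx := le_trans qe ex.
  have /negP[] := sep x x (introT (levP _ _ _ _) (And3 px xT rx))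
    (introT (levP _ _ _ _) (And3 qx xT rx)) nx nx; exact: connect0.
have c1 := @bin_le_card_lev e T r eT; have c2 := @bin_le_card_lev e T r.+1 eT.
have gimg : #|g @: [set H | lev e T r.+1 H]| = #|lev e T r.+1|.
  by rewrite card_in_imset // cardsE.
have sum : #|lev e T r| + #|g @: [set H | lev e T r.+1 H]| <=
    #|[set x in X | (p <<= x) || (q <<= x)]|.
  apply: leq_cardD => [x lx|x|x].
  - by rewrite inE (leC x lx) /=; case/levP: lx => /(le_trans pe) ->.
  - by move=> /imsetP[H]; rewrite inE => /gP[gX _ _ _ gpq] ->; rewrite inE gX.
  - move=> lx /imsetP[H]; rewrite inE => /gP[_ _ _ ng _] xE.
    by case/negP: ng; rewrite -xE; case/levP: lx.
rewrite gimg in sum; apply: leq_trans sum.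
apply: leq_trans (leq_add (c1 _) (c2 _)); rewrite re; try nat_lia.
have -> : r.+1 - (rk S).+2 = (r - (rk S).+2).+1 by nat_lia.
rewrite addnC -binS.
have -> : (rk T - (rk S).+2).+1 = rk T - (rk S).+1 by nat_lia.
have -> : (r - (rk S).+2).+1 = r - (rk S).+1 by nat_lia.
have -> : rk T - r = rk T - (rk S).+1 - (r - (rk S).+1) by nat_lia.
by apply: bin_gt_mul; nat_lia.
Qed.

(* The neighbours of [D] through an element [B < D] that misses [v]. *)
Lemma leave_vertex S T r X v D : S <<= T -> rk S < r -> r.+2 <= rk T ->
  lev S T (rk S).+1 v -> lev S T r D -> v <<= D -> D \notin X ->
  #|[set x in X | ~~ (v <<= x)]| < rk T - r ->
  exists D', [/\ lev S T r D', ~~ (v <<= D'), D' \notin X &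
    connect (adj S T r (fun z => z \notin X) xpredT) D D'].
Proof.
move=> ST Sr rT lv lD vD nD cX.
have /levP[Sv vT rv] := lv; have /levP[SD DT rD] := lD.
have nSv : S != v by apply: contra_eq_neq rv => <-; nat_lia.
have [B /levP[SB BD rB] nvB] := coatom_avoid Sv vD nSv.
have [|H lH avoid] := @cover_avoid D T [set x in X | ~~ (v <<= x)] DT.
  by rewrite rD.
have /levP[DH HT rH] := lH.
have nDH : D != H by apply: contra_eq_neq rH => <-; nat_lia.
have [D' /levP[BD' D'H rD'] nD'D] := atom_avoid BD DH nDH.
have rD'r : rk D' = r by rewrite rD' rB rD; nat_lia.
have lD' : lev S T r D'.
  by apply/levP; split=> //; [exact: le_trans BD'|exact: le_trans HT].
have nvD' : ~~ (v <<= D').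
  apply: contra nD'D => vD'; suff -> : D = D' by apply: le_refl.
  by apply: (@cover_eq B D D' v) => //; rewrite rD rB rD; nat_lia.
have nD'X : D' \notin X.
  by apply: contra nD'D => D'X; apply: avoid (D'H); rewrite inE D'X.
exists D'; split=> //; apply: (adj1 (h := H)) => //.
by apply/levP; split=> //; [exact: le_trans DH|rewrite rH rD].
Qed.

(** * The induction for arbitrary rank levels *)

Lemma levels_connected S T r X D D' : S <<= T -> rk S < r < rk T ->
  #|X| < face_conn (rk T - rk S) (r - rk S) ->
  lev S T r D -> D \notin X -> lev S T r D' -> D' \notin X ->
  connect (adj S T r (fun z => z \notin X) xpredT) D D'.
Proof.
have [n] := ubnP (r - rk S); elim: n S X D D' => // n IHn S X D D' ltn.
move=> ST /andP[Sr rT] cX lD nD lD' nD'.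
have [rS|nrS] := eqVneq r (rk S).+1.
  rewrite rS in cX lD lD' rT *; apply: atoms_connected_avoid lD nD lD' nD' => //.
  have := face_conn_le (n := rk T - rk S) (i := (rk S).+1 - rk S).
  by rewrite subSnn mul1n in cX *; nat_lia.
have [rT1|nrT1] := eqVneq r.+1 (rk T).
  apply: (adj1 (h := T)) => //; try by case/levP: lD; case/levP: lD'.
  by apply/levP; split; rewrite ?le_refl.
have rT2 : r.+2 <= rk T by nat_lia.
have nST : S != T by apply: contraTneq rT => <-; nat_lia.
pose XX v := [set x in X | v <<= x].
have [[v lv cXv]|good] : (exists2 v, lev S T (rk S).+1 v &
    face_conn (rk T - (rk S).+1) (r - (rk S).+1) <= #|XX v|) \/
    (forall v, lev S T (rk S).+1 v ->
      #|XX v| < face_conn (rk T - (rk S).+1) (r - (rk S).+1)).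
  have [/exists_inP[v lv cv]|] := boolP [exists v in lev S T (rk S).+1,
      face_conn (rk T - (rk S).+1) (r - (rk S).+1) <= #|XX v|].
    by left; exists v.
  rewrite negb_exists_in => /forall_inP no; right=> v lv.
  by rewrite ltnNge; apply: no.
- pose Y := [set x in X | ~~ (v <<= x)].
  have cY : #|X| = #|XX v| + #|Y|.
    rewrite -(cardsID [set x | v <<= x] X); congr (_ + _); apply: eq_card => x;
      by rewrite !inE // andbC.
  (* Subtract the allowance in [[v, T]] from the one in [[S, T]]: the difference is [rk T - r], and
     1 when [r.+2 = rk T]. *)
  have [cY1 cY2] : #|Y| < rk T - r /\ (r.+2 = rk T -> #|Y| = 0).
    rewrite cY /face_conn in cX cXv.
    have e1 : r - rk S = (r - (rk S).+1).+1 by nat_lia.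
    have e2 : rk T - rk S = (rk T - (rk S).+1).+1 by nat_lia.
    have e3 : rk T - rk S - (r - rk S) = rk T - r by nat_lia.
    have e4 : rk T - (rk S).+1 - (r - (rk S).+1) = rk T - r by nat_lia.
    rewrite e3 e4 e1 e2 eqSS in cX cXv.
    case: eqP cX cXv => rr; last first.
      by rewrite mulSn; move: (_ * _) => m; split; nat_lia.
    by move=> /= h1 h2; split; nat_lia.
  have notX C : ~~ (v <<= C) -> (C \notin Y) = (C \notin X).
    by move=> nv; rewrite inE nv andbT.
  have miss C : lev S T r C -> C \notin X ->
      exists C', [/\ lev S T r C', ~~ (v <<= C'), C' \notin X &
        connect (adj S T r (fun z => z \notin X) xpredT) C C'].
    move=> lC nC; have [vC|nvC] := boolP (v <<= C).
      exact: (leave_vertex ST Sr rT2 lv lC vC nC cY1).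
    by exists C; split=> //; apply: connect0.
  have [C [lC nvC nC DC]] := miss D lD nD.
  have [C' [lC' nvC' nC' DC']] := miss D' lD' nD'.
  apply: connect_trans DC _; rewrite adj_sym; apply: connect_trans DC' _.
  apply: (adj_sub (le_refl S) (le_refl T)) (levels_connected_avoid_vertex
    ST Sr rT2 cY1 _ cY2 lv lC' nvC' _ lC nvC _) => //.
  - by move=> z _ /andP[nvz]; rewrite notX.
  - by move=> rS; rewrite rS eqxx in nrS.
  - by rewrite notX.
  - by rewrite notX.
have Sr2 : (rk S).+1 < r by nat_lia.
have r_in : rk S < (rk S).+1 /\ 0 < r - (rk S).+1 /\ r - (rk S).+1 < rk T - (rk S).+1.
  by nat_lia.
have conn1 v C C' : lev S T (rk S).+1 v -> lev v T r C -> C \notin X ->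
    lev v T r C' -> C' \notin X ->
    connect (adj S T r (fun z => z \notin X) xpredT) C C'.
  move=> lv lC nC lC' nC'; have /levP[Sv vT rv] := lv.
  apply: (adj_sub Sv (le_refl T)) (IHn v (XX v) C C' _ vT _ _ lC _ lC' _) => //.
  - by move=> z /levP[vz _ _]; rewrite inE vz andbT.
  - by rewrite rv; nat_lia.
  - by rewrite rv; nat_lia.
  - by rewrite rv; apply: good.
  - by rewrite inE (negbTE nC).
  - by rewrite inE (negbTE nC').
have free v : lev S T (rk S).+1 v -> exists2 C, lev v T r C & C \notin X.
  move=> lv; have /levP[Sv vT rv] := lv.
  have [|C lC nC] := @exists_notin _ (lev v T r) (XX v).
    apply: leq_trans (good v lv) _; apply: leq_trans (face_conn_le _ _) _; try nat_lia.
    have -> : rk T - (rk S).+1 - (r - (rk S).+1) = rk T - r by nat_lia.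
    by rewrite -rv; apply: ltnW; apply: card_lev_gt => //; rewrite rv; nat_lia.
  exists C => //; move: nC; rewrite inE.
  by have /levP[-> _ _] : lev v T r C := lC; rewrite andbT.
(* By [conn1] the choice of [C] and [C'] does not matter, and by [free] there is always one; hence
   [R] is transitive on atoms and only the ends of an edge have to be related. *)
pose R v w := exists C C', [/\ lev v T r C, C \notin X, lev w T r C', C' \notin X &
  connect (adj S T r (fun z => z \notin X) xpredT) C C'].
have RE v w C C' : lev S T (rk S).+1 v -> lev S T (rk S).+1 w -> R v w ->
    lev v T r C -> C \notin X -> lev w T r C' -> C' \notin X ->
    connect (adj S T r (fun z => z \notin X) xpredT) C C'.
  move=> lv lw [B [B' [lB nB lB' nB' BB']]] lC nC lC' nC'.
  apply: connect_trans (conn1 v C B lv lC nC lB nB) _.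
  exact: connect_trans BB' (conn1 w B' C' lw lB' nB' lC' nC').
have Rrefl v : lev S T (rk S).+1 v -> R v v.
  by move=> /free[C lC nC]; exists C, C; split=> //; apply: connect0.
have Rtrans v u w : lev S T (rk S).+1 v -> lev S T (rk S).+1 u ->
    lev S T (rk S).+1 w -> R v u -> R u w -> R v w.
  move=> lv lu lw Rvu Ruw.
  have [[A lA nA] [B lB nB] [C lC nC]] := And3 (free v lv) (free u lu) (free w lw).
  exists A, C; split=> //; apply: connect_trans (RE v u A B lv lu Rvu lA nA lB nB) _.
  exact: RE u w B C lu lw Ruw lB nB lC nC.
have common v w C : lev S T r C -> C \notin X -> v <<= C -> w <<= C -> R v w.
  move=> /levP[_ CT rC] nC vC wC; exists C, C; split=> //; exact/levP.
suff edge e p q : lev S T (rk S).+1 p -> lev S T (rk S).+1 q ->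
    lev S T (rk S).+2 e -> p <<= e -> q <<= e -> R p q.
  have [v lv vD] : exists2 v, lev S T (rk S).+1 v & v <<= D.
    have /levP[SD DT rD] := lD.
    have [||v [Sv vD rv]] := @exists_rk (rk S).+1 S D; [by []|nat_lia|].
    by exists v => //; apply/levP; split=> //; apply: le_trans DT.
  have [w lw wD] : exists2 w, lev S T (rk S).+1 w & w <<= D'.
    have /levP[SD DT rD] := lD'.
    have [||w [Sw wD rw]] := @exists_rk (rk S).+1 S D'; [by []|nat_lia|].
    by exists w => //; apply/levP; split=> //; apply: le_trans DT.
  have ch := atoms_connected (le_refl S) ST nST lv (atom_not_le lv)
    lw (atom_not_le lw).
  have Rvw : R v w.
    apply: (connect_ind (P := R v) ch) => [p q Rvp|]; last exact: Rrefl.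
    case/and5P=> lp _ lq _ /existsP[e /and4P[le_e _ pe qe]].
    exact: Rtrans lv lp lq Rvp (edge e p q lp lq le_e pe qe).
  by apply: RE lv lw Rvw _ nD _ nD'; apply/levP; split=> //;
    [case/levP: lD|case/levP: lD|case/levP: lD'|case/levP: lD'].
move=> lp lq le_e pe qe.
have [<-|npq] := eqVneq p q; first exact: Rrefl.
have /levP[Se eT re] := le_e.
have [/existsP[C /existsP[C' /and5P[? ? ? ? ?]]]|sep] :=
  boolP [exists C, [exists C', [&& lev p T r C, C \notin X, lev q T r C', C' \notin X
    & connect (adj S T r (fun z => z \notin X) xpredT) C C']]].
  by exists C, C'.
have {}sep C C' : lev p T r C -> lev q T r C' -> C \notin X -> C' \notin X ->
    ~~ connect (adj S T r (fun z => z \notin X) xpredT) C C'.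
  move=> lC lC' nC nC'; apply: contra sep => CC'; apply/existsP; exists C.
  by apply/existsP; exists C'; apply/and5P.
have cXpq := separated_edge_card ST Sr2 rT lp lq npq pe qe eT re sep.
pose Y := [set x in X | ~~ ((p <<= x) || (q <<= x))].
have cY : #|X| = #|[set x in X | (p <<= x) || (q <<= x)]| + #|Y|.
  rewrite -(cardsID [set x | (p <<= x) || (q <<= x)] X).
  by congr (_ + _); apply: eq_card => x; rewrite !inE // andbC.
(* If [r.+2 = rk T], the separated edge alone needs more deletions than are allowed. Otherwise its
   share exceeds [(i - 1) * (n - i)], which leaves at most [n - i - 2] for [Y]. *)
have [rT3 cY3] : r.+3 <= rk T /\ #|Y|.+2 <= rk T - r.
  rewrite cY /face_conn in cX.
  have e1 : r - rk S = (r - (rk S).+1).+1 by nat_lia.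
  have e3 : rk T - rk S - (r - rk S) = rk T - r by nat_lia.
  rewrite e3 in cX; case: eqP cX => rr.
    have e5 : rk T - r = 2 by nat_lia.
    by rewrite e5 in cXpq *; nat_lia.
  rewrite e1 mulSn; move: cXpq; move: (_ * _) => m ? ?; nat_lia.
have link s t : lev S T (rk S).+1 s -> lev S T (rk S).+1 t ->
    s \notin [set p; q] -> t \notin [set p; q] -> R s t.
  (* For [r = (rk S).+2] the edges are themselves the elements subject to deletion, so the path must
     avoid those in [Y]. For larger [r] a surviving element is found above every edge off [p] and
     [q]. *)
  move=> ls lt ns nt; pose Xe := if r == (rk S).+2 then Y else set0.
  have cXe : (#|[set p; q]| + #|Xe|).+1 < rk T - rk S.
    by rewrite cards2 npq /Xe; case: eqP => ?; rewrite ?cards0; nat_lia.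
  have ch := atoms_connected_avoid_edges ST cXe ls ns lt nt.
  apply: (connect_ind (P := R s) ch) => [a b Rsa|]; last exact: Rrefl.
  case/and5P=> la na lb nb /existsP[e' /and4P[le' ne' ae' be']].
  apply: (Rtrans _ _ _ ls la lb Rsa).
  have [<-|nab] := eqVneq a b; first exact: Rrefl.
  have /levP[Se' e'T re'] := le'.
  move: na nb; rewrite !inE !negb_or => /andP[nap naq] /andP[nbp nbq].
  have off c : lev S T (rk S).+1 c -> a != c -> b != c -> ~~ (c <<= e').
    move=> lc nac nbc; apply/negP=> ce'.
    have := edge_atoms la lb lc re' ae' be' ce'.
    by rewrite (negbTE nab) (negbTE nac) (negbTE nbc).
  have npe' := off p lp nap nbp; have nqe' := off q lq naq nbq.
  suff [C lC nC] : exists2 C, lev e' T r C & C \notin X.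
    have /levP[e'C CT rC] := lC.
    exact: common (lev_sub Se' (le_refl T) lC) nC (le_trans ae' e'C)
      (le_trans be' e'C).
  have [r2|nr2] := eqVneq r (rk S).+2.
    exists e'; first by apply/levP; rewrite le_refl r2.
    by move: ne'; rewrite /Xe r2 eqxx inE (negbTE npe') (negbTE nqe') andbT.
  have below v G : lev S T (rk S).+1 v -> e' <<= G -> G <<= T -> rk e' < rk G ->
      ~~ (v <<= e') -> exists F, [/\ e' <<= F, F <<= G, rk F = (rk G).-1 &
        ~~ (v <<= F)].
    move=> lv e'G GT rG nve'; have [vG|nvG] := boolP (v <<= G); last first.
      have [||F [e'F FG rF]] := @exists_rk (rk G).-1 e' G; [by []|nat_lia|].
      by exists F; split=> //; apply: contra nvG => /le_trans; apply.
    have [J [e'J vJ JG] lub] := join_exists e'G vG.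
    have ne'J : e' != J by apply: contraNneq nve' => ->.
    have [F /levP[e'F FG rF] nJF] := coatom_avoid e'J JG ne'J.
    by exists F; split=> //; apply: contra nJF; apply: lub.
  (* Going down twice yields [G] of rank [rk T - 2] above [e'] with neither [p] nor [q] below it.
     Only [Y] matters under [G], and [#|Y| <= rk G - r] is too small to cover level [r] of
     [[e', G]]. *)
  have [|F [e'F FT rF npF]] := below p T lp e'T (le_refl T) _ npe'; first by nat_lia.
  have [|G [e'G GF rG nqG]] := below q F lq e'F FT _ nqe'; first by nat_lia.
  have [|C lC nC] := @exists_notin _ (lev e' G r) Y.
    apply: leq_ltn_trans _ (card_lev_gt e'G _); last by nat_lia.
    have : 1 <= r - rk e' by nat_lia.
    have : #|Y| <= rk G - r by nat_lia.
    by move=> cYG r_gt; apply: leq_trans cYG _; rewrite leq_pmull.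
  have /levP[e'C CG rC] : lev e' G r C := lC.
  exists C; first by apply/levP; split=> //; apply: le_trans CG (le_trans GF FT).
  have npC : ~~ (p <<= C).
    by apply: contra npF => pC; exact: le_trans pC (le_trans CG GF).
  have nqC : ~~ (q <<= C) by apply: contra nqG => qC; exact: le_trans qC CG.
  by move: nC; rewrite inE (negbTE npC) (negbTE nqC) andbT.
(* Everything above [e] is deleted, so a surviving element above [a] misses [b] but has a further
   atom [u]. The detour from [p] to [q] leaves and returns through such atoms. *)
have other a b : lev S T (rk S).+1 a -> lev S T (rk S).+1 b -> a <<= e -> b <<= e ->
    a != b -> (forall C, lev S T r C -> e <<= C -> C \in X) ->
    exists2 u, lev S T (rk S).+1 u & R a u /\ u \notin [set a; b].
  move=> la lb ae be nab eX; have [C lC nC] := free a la.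
  have /levP[aC CT rC] := lC; have /levP[Sa aT ra] := la.
  have lC' := lev_sub Sa (le_refl T) lC.
  have naC : a != C by apply: contra_eq_neq ra => ->; rewrite rC; nat_lia.
  have [u lu nua] := atom_avoid Sa aC naC; have /levP[Su uC ru] := lu.
  exists u; first exact: lev_sub (le_refl S) CT lu.
  split; first exact: common lC' nC aC uC.
  rewrite !inE negb_or; apply/andP; split.
    by apply: contraNneq nua => ->; apply: le_refl.
  apply: contraNneq nC => ub; apply: eX lC' _.
  by apply: (edge_le la lb nab ae be re aC); rewrite -ub.
have eX C : lev S T r C -> e <<= C -> C \in X.
  move=> lC eC; apply: contraT => nC; have /levP[_ CT rC] := lC.
  have /negP[] : ~~ connect (adj S T r (fun z => z \notin X) xpredT) C C.
    by apply: sep => //; apply/levP; split=> //; apply: le_trans eC.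
  exact: connect0.
have [u lu [Rpu nu]] := other p q lp lq pe qe npq eX.
have [w lw [Rqw nw]] := other q p lq lp qe pe (contra_neq (@esym _ _ _) npq) eX.
have Rwq : R w q.
  have [C [C' [? ? ? ? CC']]] := Rqw; exists C', C; split=> //.
  by rewrite adj_sym.
apply: (Rtrans p u q) => //; apply: (Rtrans u w q) => //.
by apply: link => //; rewrite setUC.
Qed.

End Intervals.

(** * The face lattice of a finitely generated cone *)

Import Order.TTheory GRing.Theory Num.Theory.

Section ConeFaces.
Local Open Scope ring_scope.
Variables (R : realFieldType) (m q : nat) (W : 'M[R]_(m, q)).
Implicit Types (S T A B X Y : {set 'I_m}) (g h : 'cV[R]_q) (i l : 'I_m).

Definition cval g i : R := (W *m g) i 0.

Definition supports g S :=
  forall i, 0 <= cval g i /\ (i \in S) = (cval g i == 0).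

Definition cone_face S := exists g, supports g S.

(** Rows outside [S] are set to zero instead of removed, so the matrix type does not depend on
    [S]. *)
Definition cone_span S : 'M[R]_(m, q) :=
  \matrix_i (if i \in S then row i W else 0).

Definition cone_rank S := \rank (cone_span S).

Lemma cvalE g i : cval g i = (row i W *m g) 0 0.
Proof. by rewrite -row_mul mxE. Qed.

Lemma cvalD g h i : cval (g + h) i = cval g i + cval h i.
Proof. by rewrite /cval mulmxDr mxE. Qed.

Lemma cvalZ t g i : cval (t *: g) i = t * cval g i.
Proof. by rewrite /cval -scalemxAr mxE. Qed.

Lemma cvalB t g h i : cval (g - t *: h) i = cval g i - t * cval h i.
Proof. by rewrite -scaleNr cvalD cvalZ mulNr. Qed.

Lemma supports_gt0 g S i : supports g S -> i \notin S -> 0 < cval g i.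
Proof. by move=> /(_ i)[ge0 ->] ne0; rewrite lt_def ne0 ge0. Qed.

Lemma supports_eq0 g S i : supports g S -> i \in S -> cval g i = 0.
Proof. by move=> /(_ i)[_ ->] /eqP. Qed.

Lemma row_cone_span S i : i \in S -> (row i W <= cone_span S)%MS.
Proof. by move=> iS; have := row_sub i (cone_span S); rewrite rowK iS. Qed.

Lemma cone_span_sub S n (A : 'M_(n, q)) :
  (forall i, i \in S -> (row i W <= A)%MS) -> (cone_span S <= A)%MS.
Proof.
move=> SA; apply/row_subP=> i; rewrite rowK; case: ifP => [/SA //|_].
exact: sub0mx.
Qed.

Lemma cone_spanS S T : S \subset T -> (cone_span S <= cone_span T)%MS.
Proof.
by move=> /subsetP ST; apply: cone_span_sub => i /ST; apply: row_cone_span.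
Qed.

Lemma cone_span_mul S g : (forall i, i \in S -> cval g i = 0) ->
  cone_span S *m g = 0.
Proof.
move=> Sg; apply/row_matrixP=> i; rewrite row_mul rowK row0.
case: ifP => [/Sg|]; last by rewrite mul0mx.
by rewrite cvalE => iE; apply/matrixP=> a b; rewrite !ord1 iE mxE.
Qed.

Lemma notin_cone_span S g i : supports g S -> i \notin S ->
  ~~ (row i W <= cone_span S)%MS.
Proof.
move=> gS iS; apply/negP=> /submxP[D DE].
have := supports_gt0 gS iS; rewrite cvalE DE -mulmxA cone_span_mul.
  by rewrite mulmx0 mxE ltxx.
by move=> l; apply: supports_eq0 gS.
Qed.

Lemma cone_rank_lt S T : cone_face S -> S \proper T ->
  (cone_rank S < cone_rank T)%N.
Proof.
move=> [g gS] /properP[ST [i iT iS]]; apply: rank_ltmx.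
rewrite /ltmx cone_spanS //=; apply: contra (notin_cone_span gS iS).
by apply: submx_trans; apply: row_cone_span.
Qed.

(** A face of a face is a face: a large multiple of the functional [gT] of [T] makes [g] positive
    off [T] without changing it on [T]. The sum in [K] dominates every ratio that is needed, and the
    final 1 makes the inequality strict. *)
Lemma cone_face_sub T g : cone_face T ->
  (forall l, l \in T -> 0 <= cval g l) ->
  cone_face [set l in T | cval g l == 0].
Proof.
move=> [gT supT] g_ge0; pose K := \sum_l `|cval g l| / cval gT l + 1.
have pos l : l \notin T -> 0 < cval (g + K *: gT) l.
  move=> lT; have gT_gt0 := supports_gt0 supT lT.
  rewrite cvalD cvalZ /K (bigD1 l) //= -addrA mulrDl divfK ?gt_eqF //.
  have : 0 <= \sum_(i | i != l) `|cval g i| / cval gT i.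
    by apply: sumr_ge0 => i _; rewrite divr_ge0 //; case: (supT i).
  have : 0 <= cval g l + `|cval g l| by rewrite -lerBlDl sub0r lerNl lerNnormlW.
  set s := \sum_(_ | _) _; nra.
exists (g + K *: gT) => l; rewrite inE; have [lT|lT] := boolP (l \in T).
  by rewrite cvalD cvalZ (supports_eq0 supT lT) mulr0 addr0 /= g_ge0.
by rewrite ltW ?pos //= (gt_eqF (pos l lT)).
Qed.

(* The ratio test: the supporting functional [a] is tilted towards [b] until
   it first touches a generator of [T] where [b] is positive. *)
Lemma cone_face_tilt T a b : cone_face T ->
  (forall l, l \in T -> 0 <= cval a l) -> (exists2 l, l \in T & 0 < cval b l) ->
  exists t, [/\ 0 <= t, forall l, l \in T -> 0 <= cval (a - t *: b) l,
    exists l, [/\ l \in T, 0 < cval b l & cval (a - t *: b) l = 0] &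
    cone_face [set l in T | cval (a - t *: b) l == 0]].
Proof.
move=> faceT a_ge0 [l0 l0T bl0].
have Pl0 : [pred l | (l \in T) && (0 < cval b l)] l0 by rewrite /= l0T.
case: (arg_minP (fun l => cval a l / cval b l) Pl0) => l /andP[lT bl] lmin.
exists (cval a l / cval b l); set t := _ / _.
have t_ge0 : 0 <= t by rewrite divr_ge0 ?a_ge0 // ltW.
have ge0 i : i \in T -> 0 <= cval (a - t *: b) i.
  move=> iT; rewrite cvalB subr_ge0; have [bi|bi] := ltP 0 (cval b i).
    by rewrite -ler_pdivlMr //; apply: lmin; rewrite /= iT.
  by apply: le_trans (a_ge0 i iT); rewrite mulr_ge0_le0.
split=> //; last exact: cone_face_sub.
by exists l; split=> //; rewrite cvalB divfK ?subrr // gt_eqF.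
Qed.

Lemma cone_faceI A B : cone_face A -> cone_face B -> cone_face (A :&: B).
Proof.
move=> [a supA] [b supB]; exists (a + b) => i; rewrite cvalD.
have [[a0 aE] [b0 bE]] := (supA i, supB i).
by rewrite addr_ge0 // inE aE bE paddr_eq0.
Qed.

(** The rank gap leaves a functional [h] that vanishes on [S] and on one generator [i] of [T] off
    [S], but is positive somewhere on [T]. Tilting the functional of [S] towards [h] keeps [S],
    gains a generator, and still excludes [i]. *)
Lemma cone_face_between S T : cone_face S -> cone_face T -> S \subset T ->
  ((cone_rank S).+1 < cone_rank T)%N ->
  exists X, [/\ cone_face X, S \subset X, X \subset T, X != S & X != T].
Proof.
move=> [g supS] faceT ST gap.
have /properP[_ [i iT iS]] : S \proper T.
  rewrite properEneq ST andbT; apply: contraTneq gap => ->.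
  by rewrite -leqNgt leqnSn.
pose U := (cone_span S + row i W)%MS.
have [j jT jU] : exists2 j, j \in T & ~~ (row j W <= U)%MS.
  apply/exists_inP; apply: contraTT gap; rewrite negb_exists_in => /forall_inP TU.
  rewrite -leqNgt; apply: (@leq_trans (\rank U)).
    by apply/mxrankS/cone_span_sub => l /TU; rewrite negbK.
  apply: leq_trans (mxrank_adds_leqif _ _).1 _.
  have := rank_leq_row (row i W); rewrite /cone_rank; lia.
rewrite submxE in jU.
have [k jk] : exists k, (row j W *m cokermx U) 0 k != 0.
  apply/existsP; apply: contraNT jU; rewrite negb_exists => /forallP k0.
  by apply/eqP/rowP=> k; rewrite [RHS]mxE; apply/eqP; have := k0 k; rewrite negbK.
pose h0 := col k (cokermx U).
have h0E l : cval h0 l = (row l W *m cokermx U) 0 k.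
  by rewrite cvalE /h0 colE mulmxA -colE mxE.
have h0U l : (row l W <= U)%MS -> cval h0 l = 0.
  by rewrite submxE h0E => /eqP ->; rewrite mxE.
pose h := Num.sg (cval h0 j) *: h0.
have hU l : (row l W <= U)%MS -> cval h l = 0.
  by move=> /h0U lE; rewrite cvalZ lE mulr0.
have hj : 0 < cval h j by rewrite cvalZ -normrEsg normr_gt0 h0E.
have SU l : l \in S -> (row l W <= U)%MS.
  by move=> /row_cone_span/submx_trans; apply; apply: addsmxSl.
have hi : cval h i = 0 by apply: hU; apply: addsmxSr.
have [||t [_ _ [l [lT hl lE]] faceX]] := @cone_face_tilt T g h faceT.
- by move=> l _; case: (supS l).
- by exists j.
exists [set l in T | cval (g - t *: h) l == 0]; split=> //.
- apply/subsetP=> x xS; rewrite inE (subsetP ST) //= cvalB (hU _ (SU x xS)).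
  by rewrite (supports_eq0 supS xS) mulr0 subr0.
- by apply/subsetP=> x; rewrite inE => /andP[].
- apply/eqP=> /setP/(_ l); rewrite inE lT lE eqxx => lS.
  by move: hl; rewrite hU ?ltxx // SU // -lS.
- apply/eqP=> /setP/(_ i); rewrite inE iT cvalB hi mulr0 subr0 /=.
  by rewrite gt_eqF // (supports_gt0 supS).
Qed.

(** Tilt the functional of [X] towards that of [A]. On [A] the latter is zero, so the new face meets
    [A] exactly in [X]. *)
Lemma cone_face_relcompl X A Y : cone_face X -> cone_face A -> cone_face Y ->
  X \subset A -> A \subset Y -> X != A -> A != Y ->
  exists B, [/\ cone_face B, X \subset B, B \subset Y & [/\ X != B, B != Y &
    A :&: B = X]].
Proof.
move=> [gX supX] [gA supA] faceY XA AY nXA nAY.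
have /properP[_ [i iY iA]] : A \proper Y by rewrite properEneq nAY.
have [||t [_ _ [l [lY al lE]] faceB]] := @cone_face_tilt Y gX gA faceY.
- by move=> l _; case: (supX l).
- by exists i => //; apply: supports_gt0 supA iA.
set B := [set l in Y | _] in faceB.
have AB : A :&: B = X.
  apply/setP=> x; rewrite !inE; have [xA|xA] := boolP (x \in A).
    rewrite (subsetP AY) //= cvalB (supports_eq0 supA xA) mulr0 subr0.
    by case: (supX x).
  by apply/esym/negP=> /(subsetP XA); apply/negP.
exists B; split=> //.
- by rewrite -AB subsetIr.
- by apply/subsetP=> x; rewrite inE => /andP[].
split=> //; last first.
  by apply: contra_neq nXA => BY; rewrite -AB BY; apply/setIidPl.
apply/eqP=> /setP/(_ l); rewrite inE lY lE eqxx => /(subsetP XA) lA.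
by rewrite (supports_eq0 supA lA) ltxx in al.
Qed.
End ConeFaces.

(** * The diamond property and the climbing paths *)

Section ConeLattice.
Local Open Scope ring_scope.
Variables (R : realFieldType) (m q : nat) (W : 'M[R]_(m, q)).
Implicit Types (S T A B X Y : {set 'I_m}) (g h : 'cV[R]_q) (i l : 'I_m).
Local Notation face := (cone_face W).
Local Notation cval := (cval W).
Local Notation supports := (supports W).
Local Notation rank := (cone_rank W).

Lemma cone_face_meet_atoms X A B : face X -> face A -> face B ->
  X \subset A -> X \subset B -> rank A = (rank X).+1 ->
  rank B = (rank X).+1 -> A != B -> A :&: B = X.
Proof.
move=> fX fA fB XA XB rA rB; have fAB := cone_faceI fA fB.
have XAB : X \subset A :&: B by rewrite subsetI XA.
apply: contra_neq_eq => nABX.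
have lt1 : (rank X < rank (A :&: B))%N.
  by apply: cone_rank_lt => //; rewrite properEneq XAB eq_sym nABX.
have -> : A = A :&: B.
  apply/eqP; rewrite eq_sym; apply: contraTT lt1 => nA.
  rewrite -leqNgt -ltnS -rA; apply: cone_rank_lt fAB _.
  by rewrite properEneq nA subsetIl.
apply/eqP; apply: contraTT lt1 => nB.
rewrite -leqNgt -ltnS -rB; apply: cone_rank_lt fAB _.
by rewrite properEneq nB subsetIr.
Qed.

(** Modulo the span of [X] the face [Y] is a plane cone, which has at most two rays. With generators
    [i], [j], [k] on three rays, [k] is a combination of [i] and [j]; the functionals of [A] and [B]
    make both coefficients positive, and then that of [C] could not vanish at [k]. *)
Lemma cone_face_diamond X Y A B C :
  face X -> face A -> face B -> face C -> rank Y = (rank X).+2 ->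
  X \subset A -> A \subset Y -> rank A = (rank X).+1 ->
  X \subset B -> B \subset Y -> rank B = (rank X).+1 ->
  X \subset C -> C \subset Y -> rank C = (rank X).+1 ->
  [|| A == B, A == C | B == C].
Proof.
move=> fX fA fB fC rY XA AY rA XB BY rB XC CY rC.
apply: contraT; rewrite !negb_or => /and3P[nAB nAC nBC].
have meetX (P Q : {set 'I_m}) : face P -> face Q -> X \subset P -> X \subset Q ->
    rank P = (rank X).+1 -> rank Q = (rank X).+1 -> P != Q ->
    forall i, i \in P -> i \notin X -> i \notin Q.
  move=> fP fQ XP XQ rP rQ nPQ i iP; apply: contra => iQ.
  by rewrite -(cone_face_meet_atoms fX fP fQ XP XQ rP rQ nPQ) inE iP.
have pick (P : {set 'I_m}) : X \subset P -> rank P = (rank X).+1 ->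
    exists2 i, i \in P & i \notin X.
  move=> XP rP; have /properP[_ //] : X \proper P.
  rewrite properEneq XP andbT; apply: contra_eq_neq rP => <-.
  by rewrite neq_ltn ltnSn.
have [i iA iX] := pick A XA rA; have [j jB jX] := pick B XB rB.
have [k kC kX] := pick C XC rC.
have iB := meetX A B fA fB XA XB rA rB nAB i iA iX.
have iC := meetX A C fA fC XA XC rA rC nAC i iA iX.
have jC := meetX B C fB fC XB XC rB rC nBC j jB jX.
have jA : j \notin A by apply: (meetX B A) jB jX => //; rewrite eq_sym.
have kA : k \notin A by apply: (meetX C A) kC kX => //; rewrite eq_sym.
have kB : k \notin B by apply: (meetX C B) kC kX => //; rewrite eq_sym.
have [[gX supX] [gA supA] [gB supB] [gC supC]] := And4 fX fA fB fC.
pose V := (cone_span W X + row i W)%MS; pose U := (V + row j W)%MS.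
have VA : (V <= cone_span W A)%MS.
  by rewrite addsmx_sub cone_spanS // row_cone_span.
have rV : (rank X < \rank V)%N.
  apply: rank_ltmx; rewrite /ltmx addsmxSl /= addsmx_sub submx_refl /=.
  exact: notin_cone_span supX iX.
have rU : (\rank V < \rank U)%N.
  apply: rank_ltmx; rewrite /ltmx addsmxSl /= addsmx_sub submx_refl /=.
  by apply: contra (notin_cone_span supA jA) => /submx_trans; apply.
have UY : (U <= cone_span W Y)%MS.
  rewrite addsmx_sub (submx_trans VA) ?cone_spanS //=.
  by rewrite row_cone_span // (subsetP BY).
have YU : (cone_span W Y <= U)%MS.
  rewrite -(mxrank_leqif_sup UY).2 eqn_leq mxrankS //=.
  by move: rY rV rU; rewrite /cone_rank; clear; lia.
have : (row k W <= U)%MS.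
  by apply: submx_trans YU; rewrite row_cone_span // (subsetP CY).
case/sub_addsmxP=> -[u b] /= kE.
have /sub_addsmxP[[c a] /= uE] : (u *m V <= V)%MS by apply: submxMl.
have comb g : (forall l, l \in X -> cval g l = 0) ->
    cval g k = a 0 0 * cval g i + b 0 0 * cval g j.
  move=> gX0; rewrite !cvalE kE uE !mulmxDl -!mulmxA (cone_span_mul gX0) mulmx0 add0r.
  by rewrite mxE [a]mx11_scalar [b]mx11_scalar !mul_scalar_mx !mxE !mulr1n.
have zero (P : {set 'I_m}) g : X \subset P -> supports g P ->
    forall l, l \in X -> cval g l = 0.
  by move=> XP sup l /(subsetP XP); apply: supports_eq0.
have hA := comb gA (zero A gA XA supA); have hB := comb gB (zero B gB XB supB).
have hC := comb gC (zero C gC XC supC).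
have gt0 := supports_gt0; have eq0 := supports_eq0.
rewrite (eq0 _ _ _ _ _ _ _ supA iA) mulr0 add0r in hA.
rewrite (eq0 _ _ _ _ _ _ _ supB jB) mulr0 addr0 in hB.
rewrite (eq0 _ _ _ _ _ _ _ supC kC) in hC.
have b_gt0 : 0 < b 0 0.
  by rewrite -(pmulr_lgt0 _ (gt0 _ _ _ _ _ _ _ supA jA)) -hA (gt0 _ _ _ _ _ _ _ supA kA).
have a_gt0 : 0 < a 0 0.
  by rewrite -(pmulr_lgt0 _ (gt0 _ _ _ _ _ _ _ supB iB)) -hB (gt0 _ _ _ _ _ _ _ supB kB).
suff : 0 < a 0 0 * cval gC i + b 0 0 * cval gC j by rewrite -hC ltxx.
by rewrite addr_gt0 // mulr_gt0 // (gt0 _ _ _ _ _ _ _ supC).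
Qed.

(* [X] is the face of [A] on which the ratio [gY / gS] attains its maximum. *)
Definition peak gS gY A t X :=
  [/\ 0 < t, face X, X \subset A,
      forall l, l \in A -> t * cval gY l <= cval gS l &
      forall l, l \in A -> (l \in X) = (cval gS l == t * cval gY l)].

Lemma peak_exists gS gY S Y A : supports gS S -> supports gY Y ->
  S \subset Y -> face A -> ~~ (A \subset Y) ->
  exists t X, peak gS gY A t X /\ ~~ (X \subset Y).
Proof.
move=> supS supY SY faceA /subsetPn[i iA iY].
have [||t [t_ge0 ge0 [l [lA gl lE]] faceX]] := @cone_face_tilt _ _ _ W A gS gY faceA.
- by move=> l _; case: (supS l).
- by exists i => //; apply: supports_gt0 supY iY.
have lY : l \notin Y.
  by apply: contraL gl => lY; rewrite (supports_eq0 supY lY) ltxx.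
exists t, [set l in A | cval (gS - t *: gY) l == 0]; split; last first.
  by apply/subsetPn; exists l => //; rewrite inE lA lE eqxx.
split=> //.
- rewrite lt_def t_ge0 andbT; apply: contraTneq lY => t0.
  move: lE; rewrite t0 scale0r subr0 => lE; rewrite negbK.
  by apply: (subsetP SY); case: (supS l) => _ ->; apply/eqP.
- by apply/subsetP=> x; rewrite inE => /andP[].
- by move=> x /ge0; rewrite cvalB subr_ge0.
- by move=> x xA; rewrite inE xA cvalB subr_eq0.
Qed.

(** A pivot step: [t *: gY - gS] vanishes on the peak [X] and is positive at the better generator
    [j], so tilting the functional of [X] towards it yields a face through [X] with a strictly
    better generator. On [Y] outside [S] the tilted functional stays positive, so the face is
    proper. *)
Lemma peak_climb gS gY S Y T A t X j : supports gS S -> supports gY Y ->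
  S \subset Y -> Y \subset T -> S != Y -> face T -> A \subset T ->
  peak gS gY A t X -> j \in T -> cval gS j < t * cval gY j ->
  exists B, [/\ face B, X \subset B, B \subset T, B != T &
    exists2 l, l \in B & cval gS l < t * cval gY l].
Proof.
move=> supS supY SY YT nSY faceT AT [t_gt0 [gX supX] XA tle XE] jT jlt.
have bE l : cval (t *: gY - gS) l = t * cval gY l - cval gS l.
  by rewrite -[in LHS](scale1r gS) cvalB cvalZ mul1r.
have [||r [r_ge0 ge0 [l [lT bl lE]] faceB]] :=
    @cone_face_tilt _ _ _ W T gX (t *: gY - gS) faceT.
- by move=> l _; case: (supX l).
- by exists j => //; rewrite bE subr_gt0.
set B := [set l in T | _] in faceB; exists B.
have X0 x : x \in X -> cval (t *: gY - gS) x = 0.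
  move=> xX; rewrite bE; have := XE x (subsetP XA x xX).
  by rewrite xX => /esym/eqP ->; rewrite subrr.
have lX : l \notin X by apply: contraL bl => /X0 ->; rewrite ltxx.
have r_gt0 : 0 < r.
  rewrite lt_def r_ge0 andbT; apply: contra_neq (lt0r_neq0 (supports_gt0 supX lX)).
  by move: lE; rewrite cvalB => + r0; rewrite r0 mul0r subr0.
split=> //.
- apply/subsetP=> x xX; rewrite inE (subsetP AT) ?(subsetP XA) //= cvalB X0 //.
  by rewrite (supports_eq0 supX xX) mulr0 subr0.
- by apply/subsetP=> x; rewrite inE => /andP[].
- have /properP[_ [y yY yS]] : S \proper Y by rewrite properEneq nSY.
  apply/eqP=> /setP/(_ y); rewrite inE (subsetP YT) //= cvalB bE.
  rewrite (supports_eq0 supY yY) mulr0 sub0r mulrN opprK => /eqP.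
  apply/eqP; rewrite gt_eqF // ltr_wpDl //; first by case: (supX y).
  by rewrite mulr_gt0 // (supports_gt0 supS).
- by exists l; [rewrite inE lT lE eqxx|rewrite -subr_gt0 -bE].
Qed.

Definition cface := {S : {set 'I_m} | `[< face S >]}.

Lemma cfaceP (S : cface) : face (val S).
Proof. by case: S => S fS; apply/asboolP. Qed.

Definition cface_of S (fS : face S) : cface := exist _ S (introT (asboolP _) fS).

Definition cmeet (S T : cface) : cface := cface_of (cone_faceI (cfaceP S) (cfaceP T)).

(** Each face off [Y] is linked to the face [M] of [T] where [gY / gS] is largest. The peak of a
    face [C] either can be improved, and then the next face contains this peak, or already lies in
    [M]. The number of generators better than the peak decreases. *)
Lemma cface_chain (S Y T A B : cface) :
  val S \subset val Y -> val Y \subset val T -> S != Y -> Y != T ->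
  val S \subset val A -> val A \subset val T -> A != T ->
  ~~ (val A \subset val Y) ->
  val S \subset val B -> val B \subset val T -> B != T ->
  ~~ (val B \subset val Y) ->
  connect (fun C D : cface => [&& val S \subset val C, val C \subset val T, C != T,
    val S \subset val D, val D \subset val T, D != T &
    ~~ (val (cmeet C D) \subset val Y)]) A B.
Proof.
move=> SY YT nSY nYT SA AT nAT nAY SB BT nBT nBY.
set e := (e in connect e).
have e_sym : connect_sym e.
  have imp C D : e C D -> e D C.
    by case/and5P=> ? ? ? ? /and3P[? ? nY]; apply/and5P; split=> //;
      apply/and3P; split=> //; rewrite /= setIC.
  by apply: sym_connect_sym => C D; apply/idP/idP; apply: imp.
have [[gS supS] [gY supY]] := (cfaceP S, cfaceP Y).
have nSY' : val S != val Y by [].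
have nTY : ~~ (val T \subset val Y).
  by apply: contra nYT => TY; rewrite -val_eqE eqEsubset YT.
have [tM [M [peakM nMY]]] := peak_exists supS supY SY (cfaceP T) nTY.
have [tM_gt0 faceM MT tMle ME] := peakM.
pose M' := cface_of faceM.
suff toM (C : cface) : val S \subset val C -> val C \subset val T -> C != T ->
    ~~ (val C \subset val Y) -> connect e C M'.
  by apply: connect_trans (toM A SA AT nAT nAY) _; rewrite e_sym toM.
have /properP[_ [y yY yS]] : val S \proper val Y by rewrite properEneq nSY'.
have nMT : M' != T.
  apply/eqP=> /(congr1 val)/= MTE; have := ME y (subsetP YT y yY).
  rewrite MTE (subsetP YT y yY) (supports_eq0 supY yY) mulr0 => /esym.
  by rewrite gt_eqF // (supports_gt0 supS).
have SM : val S \subset M.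
  apply/subsetP=> x xS; rewrite ME ?(subsetP YT) ?(subsetP SY) //.
  by rewrite (supports_eq0 supS xS) (supports_eq0 supY (subsetP SY x xS)) mulr0.
move=> SC CT nCT nCY; have [t [X [peakC nXY]]] := peak_exists supS supY SY (cfaceP C) nCY.
have [n] := ubnP #|[set l in val T | cval gS l < t * cval gY l]|.
elim: n C t X SC CT nCT nCY peakC nXY => // n IHn C t X SC CT nCT nCY peakC nXY.
rewrite ltnS => le_n; have [t_gt0 faceX XC tle XE] := peakC.
have [[j jT jlt]|top] := pselect (exists2 j, j \in val T & cval gS j < t * cval gY j).
  have [B0 [faceB XB0 BT0 nB0 [l lB llt]]] :=
    peak_climb supS supY SY YT nSY' (cfaceP T) CT peakC jT jlt.
  pose B' := cface_of faceB.
  have SX : val S \subset X.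
    apply/subsetP=> x xS; rewrite XE ?(subsetP SC) //.
    by rewrite (supports_eq0 supS xS) (supports_eq0 supY (subsetP SY x xS)) mulr0.
  have SB' : val S \subset val B' by apply: subset_trans SX XB0.
  have nB'Y : ~~ (val B' \subset val Y) by apply: contra nXY => /(subset_trans XB0).
  have [t' [X' [peakB nX'Y]]] := peak_exists supS supY SY faceB nB'Y.
  have [t'_gt0 _ _ t'le _] := peakB.
  have nB'T : B' != T by rewrite -val_eqE.
  have IHB : connect e B' M'.
    apply: (IHn B' t' X' SB' BT0 nB'T nB'Y peakB nX'Y).
    apply: leq_trans le_n; apply: proper_card; apply/properP; split.
      apply/subsetP=> x; rewrite !inE => /andP[-> xlt] /=; apply: lt_le_trans xlt _.
      have gl : 0 < cval gY l.
        rewrite -(pmulr_rgt0 _ t_gt0); apply: le_lt_trans llt.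
        by case: (supS l).
      have := le_lt_trans (t'le l lB) llt; rewrite ltr_pM2r // => tt'.
      by apply: ler_wpM2r (ltW tt'); case: (supY x).
    exists l; rewrite inE (subsetP BT0 l lB) //=.
    by rewrite -leNgt t'le.
  apply: connect_trans _ IHB.
  apply: connect1; apply/and5P; split=> //; apply/and3P; split=> //.
  by apply: contra nXY => /=; apply: subset_trans; rewrite subsetI XC.
have tle' x : x \in val T -> t * cval gY x <= cval gS x.
  by move=> xT; rewrite leNgt; apply/negP=> xlt; apply: top; exists x.
have tE : t = tM.
  have [[i iX iY] [k kM kY]] := (subsetPn nXY, subsetPn nMY).
  have [gi gk] := (supports_gt0 supY iY, supports_gt0 supY kY).
  have iC := subsetP XC i iX; have kT := subsetP MT k kM.
  have := tMle i (subsetP CT i iC); have := XE i iC; rewrite iX => /esym/eqP ->.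
  rewrite ler_pM2r // => le1.
  have := tle' k kT; have := ME k kT; rewrite kM => /esym/eqP ->.
  by rewrite ler_pM2r // => le2; apply: le_anti; rewrite le1 le2.
apply: connect1; apply/and5P; split=> //; apply/and3P; split=> //.
apply: contra nXY => /=; apply: subset_trans; apply/subsetP=> x xX.
have xC := subsetP XC x xX; rewrite inE xC /= ME ?(subsetP CT) //.
by rewrite -tE -XE.
Qed.

Definition cone_lattice : face_lattice.
Proof.
refine (@FaceLattice cface (fun S T : cface => val S \subset val T) cmeet
  (fun S : cface => rank (val S)) _ _ _ _ _ _ _ _ _ cface_chain).
- by move=> S; apply: subxx.
- by move=> T S U; apply: subset_trans.
- by move=> S T; apply: subsetIl.
- by move=> S T; apply: subsetIr.
- by move=> U S T US UT; rewrite subsetI US.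
- move=> S T ST nST; apply: cone_rank_lt (cfaceP S) _.
  by rewrite properEneq ST andbT.
- move=> S T ST gap.
  have [X [fX SX XT nXS nXT]] :=
    cone_face_between (cfaceP S) (cfaceP T) ST gap.
  by exists (cface_of fX); split=> //; rewrite -val_eqE.
- move=> X A Y XA AY nXA nAY.
  have [B [fB XB BY [nXB nBY AB]]] := cone_face_relcompl (cfaceP X) (cfaceP A)
    (cfaceP Y) XA AY nXA nAY.
  exists (cface_of fB); split=> //; try by rewrite -val_eqE.
  exact: val_inj.
- move=> X Y A B C rY XA AY rA XB BY rB XC CY rC.
  exact: (cone_face_diamond (cfaceP X) (cfaceP A) (cfaceP B) (cfaceP C) rY
    XA AY rA XB BY rB XC CY rC).
Defined.
End ConeLattice.

(** * Faces of a polytope *)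

Section PolytopeFaces.
Local Open Scope ring_scope.
Variables (R : realType) (N n : nat) (V : 'I_n -> 'rV[R]_N).
Implicit Types (S : {set 'I_n}) (x c : 'rV[R]_N) (i : 'I_n).

(** The polytope is placed at height 1: a face of dimension [k] spans a linear space of rank
    [k.+1]. *)
Definition homog x : 'rV[R]_(1 + N) := row_mx 1 x.

Definition homog_mx : 'M[R]_(n, 1 + N) := \matrix_i homog (V i).

Definition hull S : set 'rV[R]_N := fun x => exists w : 'I_n -> R,
  [/\ forall i, 0 <= w i, \sum_i w i = 1, forall i, i \notin S -> w i = 0 &
    x = \sum_i w i *: V i].

(** The slack of the inequality [dotv c x <= b], as a linear functional of [homog x]. *)
Definition affine_fun c b : 'cV[R]_(1 + N) := col_mx b%:M (- c^T).

Lemma dotv_mulmx c x : dotv c x = (x *m c^T) 0 0.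
Proof. by rewrite mxE; apply: eq_bigr => i _; rewrite mxE mulrC. Qed.

Lemma cval_affine_fun c b i : cval homog_mx (affine_fun c b) i = b - dotv c (V i).
Proof.
rewrite cvalE rowK mul_row_col mulmxN mul1mx dotv_mulmx.
by rewrite !mxE eqxx mulr1n.
Qed.

Lemma affine_funP (g : 'cV[R]_(1 + N)) : exists c b, g = affine_fun c b.
Proof.
exists (- (dsubmx g)^T), (usubmx g 0 0).
by rewrite /affine_fun -mx11_scalar linearN /= trmxK opprK vsubmxK.
Qed.

Lemma dotv_sum c b (w : 'I_n -> R) : \sum_i w i = 1 ->
  b - dotv c (\sum_i w i *: V i) = \sum_i w i * (b - dotv c (V i)).
Proof.
move=> w1; rewrite dotv_mulmx mulmx_suml summxE.
rewrite -{1}[b]mul1r -w1 mulr_suml -sumrB; apply: eq_bigr => i _.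
by rewrite mulrBr -scalemxAl mxE dotv_mulmx.
Qed.

Lemma vertex_hull S i : i \in S -> hull S (V i).
Proof.
move=> iS; exists (fun j => (j == i)%:R); split.
- by move=> j; rewrite ler0n.
- by rewrite (bigD1 i) //= big1 => [|j /negPf -> //]; rewrite eqxx addr0.
- by move=> j; apply: contraNeq; case: (eqVneq j i) => [->|]; rewrite ?eqxx.
- rewrite (bigD1 i) //= big1 => [|j /negPf ->]; last by rewrite scale0r.
  by rewrite eqxx scale1r addr0.
Qed.

Lemma conv_hull : conv V = hull [set: 'I_n].
Proof.
apply/funext=> x; apply/propext; split.
  by move=> [w [w0 [w1 xE]]]; exists w; split=> // i; rewrite inE.
by move=> [w [w0 w1 _ xE]]; exists w.
Qed.

Lemma hull_sub S S' x : S \subset S' -> hull S x -> hull S' x.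
Proof.
move=> SS' [w [w0 w1 wS xE]]; exists w; split=> // i iS'.
by apply: wS; apply: contra iS'; apply: (subsetP SS').
Qed.

(** The slack at a convex combination is the weighted mean of nonnegative slacks, so it vanishes
    exactly when the weights sit on tight generators. *)
Lemma hull_valid c b S : (forall i, dotv c (V i) <= b) ->
  (forall i, (i \in S) = (dotv c (V i) == b)) ->
  (fun x => conv V x /\ dotv c x = b) = hull S.
Proof.
move=> valid SE; apply/funext=> x; apply/propext; split.
  move=> [[w [w0 [w1 xE]]] cx]; exists w; split=> // i iS.
  have : \sum_i w i * (b - dotv c (V i)) == 0.
    by rewrite -dotv_sum // -xE cx subrr.
  rewrite psumr_eq0 => [/allP/(_ i)|j _]; last by rewrite mulr_ge0 ?subr_ge0.
  rewrite mem_index_enum => /(_ isT); rewrite mulf_eq0 => /orP[/eqP //|].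
  by rewrite subr_eq0 eq_sym -SE (negbTE iS).
move=> [w [w0 w1 wS xE]]; split; first by exists w.
apply/esym/eqP; rewrite -subr_eq0 xE dotv_sum // big1 // => i _.
have [iS|/wS ->] := boolP (i \in S); last by rewrite mul0r.
by move: iS; rewrite SE => /eqP ->; rewrite subrr mulr0.
Qed.

Lemma face_hullP F : face (conv V) F <->
  exists2 S, cone_face homog_mx S & F = hull S.
Proof.
split=> [[c [b [valid ->]]]|[S [g supS] ->]].
  have le_b i : dotv c (V i) <= b.
    by apply: valid; rewrite conv_hull; apply: vertex_hull; rewrite inE.
  exists [set i | dotv c (V i) == b].
    exists (affine_fun c b) => i; rewrite cval_affine_fun inE subr_ge0 le_b.
    by rewrite subr_eq0 eq_sym.
  by apply: hull_valid => // i; rewrite inE.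
have [c [b gE]] := affine_funP g; rewrite {}gE in supS.
have le_b i : dotv c (V i) <= b.
  by have [] := supS i; rewrite cval_affine_fun subr_ge0.
exists c, b; split.
  move=> _ [w [w0 [w1 ->]]]; rewrite -subr_ge0 dotv_sum //.
  by apply: sumr_ge0 => i _; rewrite mulr_ge0 // subr_ge0.
apply/esym/hull_valid => // i; have [_ ->] := supS i.
by rewrite cval_affine_fun subr_eq0 eq_sym.
Qed.

(** Generators may coincide or fail to be vertices; [i] belongs to [S] because [S] consists of all
    the tight generators. *)
Lemma hull_vertex S i : cone_face homog_mx S -> hull S (V i) -> i \in S.
Proof.
move=> fS; have [g supS] := fS; have [c [b gE]] := affine_funP g.
rewrite {}gE in supS.
have le_b j : dotv c (V j) <= b.
  by have [] := supS j; rewrite cval_affine_fun subr_ge0.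
have SE j : (j \in S) = (dotv c (V j) == b).
  by have [_ ->] := supS j; rewrite cval_affine_fun subr_eq0 eq_sym.
by rewrite -(hull_valid le_b SE) SE => -[_ ->].
Qed.

Lemma hull_subset S S' : cone_face homog_mx S' ->
  (forall x, hull S x -> hull S' x) -> S \subset S'.
Proof.
by move=> fS' SS'; apply/subsetP=> i /vertex_hull/SS'; apply: hull_vertex.
Qed.

Lemma hull_inj S S' : cone_face homog_mx S -> cone_face homog_mx S' ->
  hull S = hull S' -> S = S'.
Proof.
move=> fS fS' SS'; apply/eqP; rewrite eqEsubset; apply/andP; split;
  by apply: hull_subset => // x; rewrite SS'.
Qed.

Lemma homogE x : homog x = homog 0 + row_mx 0 x.
Proof. by rewrite /homog add_row_mx addr0 add0r. Qed.

Lemma homog_sum (w : 'I_n -> R) : \sum_i w i = 1 ->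
  homog (\sum_i w i *: V i) = \sum_i w i *: homog (V i).
Proof.
have lin y : row_mx (0 : 'rV_1) y = y *m row_mx 0 1%:M.
  by rewrite mul_mx_row mulmx0 mulmx1.
move=> w1; rewrite [RHS](eq_bigr
  (fun i => w i *: homog 0 + (w i *: V i) *m row_mx 0 1%:M)) => [|i _].
  by rewrite big_split /= -scaler_suml w1 scale1r -mulmx_suml -lin -homogE.
by rewrite homogE scalerDr lin scalemxAl.
Qed.

Lemma homog_vertex S i : i \in S -> (homog (V i) <= cone_span homog_mx S)%MS.
Proof. by move=> iS; have := row_cone_span homog_mx iS; rewrite rowK. Qed.

Lemma homog_hull S x : hull S x -> (homog x <= cone_span homog_mx S)%MS.
Proof.
move=> [w [w0 w1 wS ->]]; rewrite homog_sum //; apply: summx_sub => i _.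
have [iS|/wS ->] := boolP (i \in S); last by rewrite scale0r sub0mx.
by rewrite scalemx_sub // homog_vertex.
Qed.

Lemma row_free_affine_frame k (p : 'rV[R]_N) (B : 'M[R]_(k, N)) :
  row_free B -> row_free (col_mx (homog p) (row_mx 0 B)).
Proof.
move=> /row_freeP[B' BB']; apply/row_freeP.
exists (block_mx 1 (- p *m B') 0 B').
rewrite /homog -block_mxEv mulmx_block !mul1mx !mulmx0 !mul0mx !addr0 add0r BB'.
by rewrite mulNmx addNr -scalar_mx_block.
Qed.

Lemma affdim_cone_rank S k : affdim (hull S) k -> cone_rank homog_mx S = k.+1.
Proof.
move=> [p [Sp [B [freeB [SB spanB]]]]].
have /eqP rM := row_free_affine_frame p freeB; rewrite -[k.+1]/(1 + k)%N -rM.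
apply/eqP; rewrite /cone_rank eqn_leq !mxrankS //.
  rewrite col_mx_sub homog_hull //=; apply/row_subP => i.
  have -> : row i (row_mx 0 B) = homog (p + row i B) - homog p.
    by rewrite row_row_mx row0 /homog opp_row_mx add_row_mx subrr addrAC subrr add0r.
  by rewrite addmx_sub ?eqmx_opp ?homog_hull.
apply: cone_span_sub => i iS; rewrite rowK.
have -> : homog (V i) = homog p + row_mx 0 (V i - p).
  by rewrite /homog add_row_mx addr0 addrC subrK.
rewrite addmx_sub //; first by rewrite -addsmxE addsmxSl.
have /submxP[D ->] := spanB _ (vertex_hull iS).
rewrite -{1}(mulmx0 _ D) -mul_mx_row; apply: submx_trans (submxMl _ _) _.
by rewrite -addsmxE addsmxSr.
Qed.

(** It is enough to exhibit some dimension, here the rank of the differences to one generator;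
    [affdim_cone_rank] then identifies it as [k]. *)
Lemma cone_rank_affdim S k : cone_rank homog_mx S = k.+1 -> affdim (hull S) k.
Proof.
move=> rS; have [i0 i0S] : exists i, i \in S.
  apply/set0Pn; apply: contra_eq_neq rS => ->; rewrite /cone_rank.
  suff -> : cone_span homog_mx set0 = 0 by rewrite mxrank0.
  by apply/row_matrixP=> i; rewrite rowK inE row0.
pose D := \matrix_i (if i \in S then V i - V i0 else 0).
have dimD : affdim (hull S) (\rank D).
  exists (V i0); split; first exact: vertex_hull.
  exists (rowsub (maxrankfun D) D); split; first exact: maxrowsub_free.
  split=> [i|x [w [w0 w1 wS ->]]].
    rewrite row_rowsub rowK; case: ifP => [iS|_]; last first.
      by rewrite addr0; apply: vertex_hull.
    by rewrite addrC subrK; apply: vertex_hull.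
  rewrite eq_maxrowsub -[V i0]scale1r -w1 scaler_suml -sumrB.
  apply: summx_sub => i _; rewrite -scalerBr.
  have [iS|/wS ->] := boolP (i \in S); last by rewrite scale0r sub0mx.
  by rewrite scalemx_sub //; have := row_sub i D; rewrite rowK iS.
by have := affdim_cone_rank dimD; rewrite rS => -[->].
Qed.

Lemma kface_hullP k F : kface (conv V) k F <->
  exists S, [/\ cone_face homog_mx S, cone_rank homog_mx S = k.+1 & F = hull S].
Proof.
split=> [[/face_hullP[S fS ->] /affdim_cone_rank rS]|[S [fS rS ->]]].
  by exists S.
by split; [apply/face_hullP; exists S|apply: cone_rank_affdim].
Qed.

Lemma cone_faceT : cone_face homog_mx [set: 'I_n].
Proof.
by exists 0 => i; rewrite inE /cval mulmx0 mxE lexx eqxx.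
Qed.

Lemma cone_face0 : cone_face homog_mx set0.
Proof.
exists (affine_fun 0 1) => i; rewrite cval_affine_fun inE /dotv.
rewrite big1 => [|j _]; last by rewrite mxE mul0r.
by rewrite subr0 ler01 oner_eq0.
Qed.

Lemma cone_rank0 : cone_rank homog_mx set0 = 0%N.
Proof.
rewrite /cone_rank (_ : cone_span homog_mx set0 = 0) ?mxrank0 //.
by apply/row_matrixP=> i; rewrite rowK inE row0.
Qed.

(** * Transfer of the lower bound to the graph of k-faces *)

Lemma Gk_connected d k : affdim (conv V) d -> (k < d)%N ->
  m_connected (kface (conv V) k) (kadj (conv V) k) (face_conn d.+1 k.+1).
Proof.
rewrite conv_hull => /affdim_cone_rank rT ltkd; rewrite -conv_hull.
pose L := cone_lattice homog_mx.
pose bot : L := cface_of cone_face0; pose top : L := cface_of cone_faceT.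
have bt : le bot top by apply: sub0set.
have rk_bot : rk bot = 0%N by apply: cone_rank0.
have rk_top : rk top = d.+1 by [].
have lev_ k' (F : L) : lev bot top k' F = (rk F == k').
  by rewrite /lev /= sub0set subsetT.
pose H (F : L) := hull (val F).
have H_inj : injective H.
  by move=> F G /hull_inj FG; apply: val_inj; apply: FG; apply: cfaceP.
have HP k' F : lev bot top k'.+1 F -> kface (conv V) k' (H F).
  rewrite lev_ => /eqP rF; apply/kface_hullP; exists (val F); split=> //.
  exact: cfaceP.
have HV k' X : kface (conv V) k' X -> exists2 F, lev bot top k'.+1 F & X = H F.
  move=> /kface_hullP[S [fS rS ->]]; exists (cface_of fS : L) => //.
  by rewrite lev_; apply/eqP.
have conn_le : (face_conn d.+1 k.+1 < #|lev bot top k.+1|)%N.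
  apply: leq_ltn_trans (face_conn_le _ _) _ => //.
  have := @card_lev_gt L bot top k.+1 bt; rewrite rk_bot rk_top !subn0; apply.
  by rewrite leq0n ltnS ltnW.
split.
  exists (fun i : 'I_(face_conn d.+1 k.+1).+1 =>
    H (enum_val (widen_ord conn_le i))); split.
    by move=> i j /H_inj/enum_val_inj/(congr1 val)/= ij; apply: val_inj.
  by move=> i; apply: HP; apply: (enum_valP (widen_ord conn_le i)).
move=> j s le_j u v uV vV su sv.
have [A lA uA] := HV k u uV; have [B lB vB] := HV k v vV.
(* A deleted set that is not a face is sent to [bot], whose rank 0 keeps it off the level [k.+1]. *)
pose h (l : 'I_j) := odflt bot [pick F | `[< s l = H F >]].
pose X := h @: 'I_j.
have hX F : lev bot top k.+1 F -> F \notin X -> forall l, s l <> H F.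
  move=> _ nF l sF; case/negP: nF; apply/imsetP; exists l => //.
  rewrite /h; case: pickP => [G /asboolP sG|/(_ F)/asboolP//].
  by apply: H_inj; rewrite -sF.
have Xh F : lev bot top k.+1 F -> (forall l, s l <> H F) -> F \notin X.
  rewrite lev_ => /eqP rF sF; apply/negP=> /imsetP[l _ FE]; move: rF; rewrite FE /h.
  case: pickP => [G /asboolP sG|_] rG; last first.
    by have : rk bot = k.+1 by []; rewrite rk_bot.
  apply: (sF l); rewrite sG FE /h.
  case: pickP => [G' /asboolP sG'|/(_ G)/asboolP//].
  by rewrite -sG -sG'.
have cX : (#|X| < face_conn (rk top - rk bot) (k.+1 - rk bot))%N.
  rewrite rk_bot rk_top !subn0; apply: leq_ltn_trans (leq_imset_card _ _) _.
  (* Positivity turns [j <= m - 1], with truncated subtraction, into [j < m]. *)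
  have : (0 < face_conn d.+1 k.+1)%N by rewrite /face_conn; case: eqP => /= ?; nia.
  by rewrite card_ord; lia.
have nA : A \notin X by apply: Xh lA _; rewrite -uA.
have nB : B \notin X by apply: Xh lB _; rewrite -vB.
have := @levels_connected L bot top k.+1 X A B bt _ cX lA nA lB nB.
rewrite rk_bot rk_top /= ltnS ltkd => /(_ isT)/connectP[p0 path0 last0].
(* [adj] allows loops while [kadj] requires distinct faces, so the path is made free of
   repetitions. *)
case/shortenP: path0 last0 => p pathp uniqp _ BE.
have edge (i : nat) : (i < size p)%N ->
    adj bot top k.+1 (fun z => z \notin X) xpredT (nth A (A :: p) i) (nth A p i).
  exact: (pathP A pathp).
rewrite uA; exists (size p), (fun t : nat => H (nth A (A :: p) t)); split=> //; split.
  by rewrite vB BE (last_nth A).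
have node (i : nat) : (i <= size p)%N -> lev bot top k.+1 (nth A (A :: p) i) /\
    nth A (A :: p) i \notin X.
  by case: i => [//|i] /edge/and5P[].
split=> [i /node[lF nF]|i lt_i].
  by split; [apply: HP|apply: hX].
have [lF _] := node i (ltnW lt_i); have [lG _] := node i.+1 lt_i.
split; first exact: HP lF.
split; first exact: HP lG.
split.
  move=> /H_inj/eqP; rewrite nth_uniq //= ?ltnS 1?ltnW //.
  by rewrite eqn_leq ltnn andbF.
have /and5P[_ _ _ _ /existsP[K /and4P[lK _ FK GK]]] := edge i lt_i.
by exists (H K); split; [apply: HP lK|split=> x; apply: hull_sub].
Qed.
End PolytopeFaces.

(** * Simplices and bipyramids *)

Section RankCard.
Variables (R : realFieldType) (m q : nat) (W : 'M[R]_(m, q)).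
Implicit Types S T : {set 'I_m}.

Lemma cone_rank_le_card S : cone_rank W S <= #|S|.
Proof.
have [n] := ubnP #|S|; elim: n S => // n IHn S; rewrite ltnS => leSn.
have [->|[i iS]] := set_0Vmem S.
  rewrite cards0 leqn0 mxrank_eq0; apply/eqP/row_matrixP=> i.
  by rewrite rowK inE row0.
have cS := cardsD1 i S; rewrite iS /= in cS.
have sub : (cone_span W S <= cone_span W (S :\ i) + row i W)%MS.
  apply: cone_span_sub => l lS; have [->|nli] := eqVneq l i; first exact: addsmxSr.
  by apply: submx_trans (addsmxSl _ _); apply: row_cone_span; rewrite !inE nli.
have := leq_trans (mxrankS sub) (mxrank_adds_leqif _ _).1.
have := rank_leq_row (row i W); have : cone_rank W (S :\ i) <= #|S :\ i|.
  by apply: IHn; rewrite cS in leSn.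
move=> r1 r2 r3; rewrite cS addnC; exact: leq_trans r3 (leq_add r1 r2).
Qed.

(** Removing the generators one by one gives a chain of faces along which the rank drops strictly,
    so it is at least [#|S|]. *)
Lemma cone_rank_simplex S : (forall T, T \subset S -> cone_face W T) ->
  cone_rank W S = #|S|.
Proof.
move=> fS; apply/eqP; rewrite eqn_leq cone_rank_le_card /=.
have [n] := ubnP #|S|; elim: n S fS => // n IHn S fS; rewrite ltnS => leSn.
have [->|[i iS]] := set_0Vmem S; first by rewrite cards0.
have cS := cardsD1 i S; rewrite iS /= in cS; rewrite cS.
apply: leq_ltn_trans (IHn (S :\ i) _ _) _.
- by move=> T /subset_trans TS; apply/fS/TS/subD1set.
- by rewrite cS in leSn.
- by apply: cone_rank_lt; [apply/fS/subD1set|apply: properD1].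
Qed.
End RankCard.

(** * Upper bound from the simplex *)

Section Simplex.
Local Open Scope ring_scope.
Variables (R : realType) (d : nat).
Local Notation I := 'I_d.+1.
Implicit Types S : {set I}.

Definition simplex_vertex (i : I) : 'rV[R]_d.+1 := delta_mx 0 i.
Local Notation V := simplex_vertex.
Local Notation W := (homog_mx V).

Lemma dotv_delta N (c : 'rV[R]_N) i : dotv c (delta_mx 0 i) = c 0 i.
Proof.
rewrite /dotv (bigD1 i) //= big1 => [|j /negPf ji]; rewrite !mxE !eqxx.
  by rewrite mulr1 addr0.
by rewrite ji mulr0.
Qed.

Lemma simplex_face S : cone_face W S.
Proof.
exists (affine_fun (\row_i - (i \notin S)%:R) 0) => i.
rewrite cval_affine_fun dotv_delta mxE sub0r opprK ler0n.
by rewrite pnatr_eq0 eqb0 negbK.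
Qed.

Lemma simplex_rank S : cone_rank W S = #|S|.
Proof. by apply: cone_rank_simplex => T _; apply: simplex_face. Qed.

Lemma affdim_simplex : affdim (conv V) d.
Proof.
by rewrite conv_hull; apply: cone_rank_affdim; rewrite simplex_rank cardsT card_ord.
Qed.

Lemma kface_simplexP k F : kface (conv V) k F <->
  exists S : {set I}, #|S| = k.+1 /\ F = hull V S.
Proof.
rewrite kface_hullP; split=> [[S [_ rS ->]]|[S [cS ->]]]; exists S.
  by rewrite -simplex_rank.
by rewrite simplex_rank; split=> //; apply: simplex_face.
Qed.

Lemma simplex_hull_inj : injective (hull V).
Proof. by move=> S S' /hull_inj; apply; apply: simplex_face. Qed.

(** Counting nodes already gives the sharp bound for [k = 0] and [k = d - 1], where the simplex has
    [d.+1] faces of dimension [k]. *)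
Lemma simplex_connected_bin k m :
  m_connected (kface (conv V) k) (kadj (conv V) k) m -> (m < 'C(d.+1, k.+1))%N.
Proof.
move=> [[f [f_inj fV]] _].
have [S SE] := choice (fun i => (kface_simplexP k (f i)).1 (fV i)).
have S_inj : injective S.
  by move=> i j Sij; apply: f_inj; have [_ ->] := SE i; have [_ ->] := SE j; rewrite Sij.
rewrite -[d.+1]card_ord -card_draws -[m.+1]card_ord -(card_imset _ S_inj).
apply/subset_leq_card/subsetP=> _ /imsetP[i _ ->]; rewrite inE.
by have [-> _] := SE i.
Qed.

Lemma card_cover_exchange S S' (K : {set I}) n : #|S| = n -> #|S'| = n ->
  #|K| = n.+1 -> S \subset K -> S' \subset K -> S != S' ->
  exists a b, [/\ a \in S, b \notin S & S' = b |: (S :\ a)].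
Proof.
move=> cS cS' cK SK S'K nSS'.
have [a aS aS'] : exists2 a, a \in S & a \notin S'.
  by apply/subsetPn; apply: contra nSS' => SS'; rewrite eqEcard SS' cS cS' leqnn.
have [b bK bS] : exists2 b, b \in K & b \notin S.
  by apply/subsetPn/negP => /subset_leq_card; rewrite cK cS ltnn.
exists a, b; split=> //.
have KE : K = b |: S.
  by apply/esym/eqP; rewrite eqEcard subUset sub1set bK SK cardsU1 bS cS cK leqnn.
apply/eqP; rewrite eqEcard cardsU1 !inE negb_and negbK bS orbT cS'.
have := cardsD1 a S; rewrite aS cS => ->; rewrite leqnn andbT.
apply/subsetP=> x xS'; have := subsetP S'K x xS'; rewrite KE !inE.
by have -> : x != a by apply: contraNneq aS' => <-.
Qed.

Lemma simplex_connected_mul k m : (0 < k)%N -> (k.+3 <= d)%N ->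
  m_connected (kface (conv V) k) (kadj (conv V) k) m ->
  (m <= k.+1 * (d - k))%N.
Proof.
move=> k_gt0 kd [_ conn]; rewrite leqNgt; apply/negP=> lt_m.
(* [A] is [{0, ..., k}] and [B] is [{2, ..., k + 2}]. Since [0 < k], both 0 and 1 lie in [A] but not
   in [B]; so [B] is not a neighbour of [A] and survives the deletion of all neighbours. *)
pose A : {set I} := [set inord i | i : 'I_k.+1].
pose B : {set I} := [set inord i.+2 | i : 'I_k.+1].
have cA : #|A| = k.+1.
  rewrite card_imset ?card_ord // => i j /(congr1 val)/=.
  by rewrite !inordK => [/val_inj //||]; have := ltn_ord i; have := ltn_ord j; lia.
have cB : #|B| = k.+1.
  rewrite card_imset ?card_ord // => i j /(congr1 val)/=.
  by rewrite !inordK => [[/val_inj] //||]; have := ltn_ord i; have := ltn_ord j; lia.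
have lt2k : (1 < k.+1)%N by [].
have AB a : exists2 x, x \in A & x \notin a |: B.
  have small i : (i < 2)%N -> (inord i : I) \in A /\ (inord i : I) \notin B.
    move=> i2; split; first by apply/imsetP; exists (inord i); rewrite ?inordK //; lia.
    apply/imsetP=> -[j _ /(congr1 val)/=]; rewrite !inordK; have := ltn_ord j; lia.
  have [[A0 B0] [A1 B1]] := (small 0 isT, small 1 isT).
  have [a0|na0] := eqVneq (inord 0) a; last first.
    by exists (inord 0); rewrite // !inE negb_or na0.
  exists (inord 1); rewrite // !inE negb_or B1 andbT -a0.
  by apply/eqP=> /(congr1 val)/=; rewrite !inordK; lia.
(* The neighbours of [A] arise by exchanging one element of [A] for one outside. *)
pose D := setX A (~: A).
have cD : #|D| = (k.+1 * (d - k))%N.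
  by rewrite cardsX cA -[#|~: A|](addKn #|A|) cardsC card_ord cA subSS.
pose s (l : 'I_(#|D|)) := let: (a, b) := enum_val l in hull V (b |: (A :\ a)).
have sP l : exists a b, [/\ a \in A, b \notin A & s l = hull V (b |: (A :\ a))].
  rewrite /s; have := enum_valP l; case: (enum_val l) => a b.
  by rewrite !inE => /andP[aA bA]; exists a, b.
have [|||||n [p [p0 [pn [pV pE]]]]] := conn #|D| s _ (hull V A) (hull V B).
- by rewrite cD; lia.
- by apply/kface_simplexP; exists A.
- by apply/kface_simplexP; exists B.
- move=> l; have [a [b [_ bA ->]]] := sP l => /simplex_hull_inj/setP/(_ b).
  by rewrite setU11 (negbTE bA).
- move=> l; have [a [b [aA bA ->]]] := sP l => /simplex_hull_inj BE.
  have [x xA] := AB a; rewrite -BE !inE !negb_or xA.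
  by case: (x == a); rewrite // andbF.
case: n pn pV pE => [|n] pn pV pE.
  have [x xA] := AB (inord 0); rewrite !inE negb_or => /andP[_ xB].
  by move: pn; rewrite p0 => /simplex_hull_inj AE; rewrite -AE xA in xB.
have [_ [/kface_simplexP[S [cS pS]] [nAS [H [/kface_simplexP[K [cK ->]] [AK SK]]]]]] :=
  pE 0%N isT.
rewrite p0 pS in nAS AK SK.
have nSA : A != S by apply/eqP=> AS; apply: nAS; rewrite AS.
have [||a [b [aA bA SE]]] := card_cover_exchange cA cS cK _ _ nSA.
- by apply: hull_subset AK; apply: simplex_face.
- by apply: hull_subset SK; apply: simplex_face.
have abD : (a, b) \in D by rewrite !inE aA bA.
have [_ /(_ (enum_rank_in abD (a, b)))] := pV 1%N isT; apply.
by rewrite /s enum_rankK_in // pS SE.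
Qed.
End Simplex.

(** * Upper bound from the bipyramid *)

Section Bipyramid.
Local Open Scope ring_scope.
Variables (R : realType) (d : nat).
Hypothesis d_gt0 : (0 < d)%N.
Local Notation I := 'I_(d + 2).
Implicit Types (S K : {set I}) (a : 'I_d) (s : 'I_2).

Definition apex_height s : R := if s == 0 then 1 else -1.

(* The apices are [(1, ..., 1, 1)] and [(1, ..., 1, -1)]; the segment between
   them meets the base, with vertices [d *: e_a], in its barycenter. *)
Definition bipyramid_vertex (i : I) : 'rV[R]_(d + 1) :=
  match split i with
  | inl a => row_mx (d%:R *: delta_mx 0 a) 0
  | inr s => row_mx (const_mx 1) (const_mx (apex_height s))
  end.
Local Notation V := bipyramid_vertex.
Local Notation W := (homog_mx V).
Local Notation base a := (lshift 2 a : I).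
Local Notation apex s := (rshift d s : I).

Lemma dotv_row_mx n1 n2 (c x : 'rV[R]_n1) (e y : 'rV[R]_n2) :
  dotv (row_mx c e) (row_mx x y) = dotv c x + dotv e y.
Proof.
rewrite /dotv big_split_ord /=.
by congr (_ + _); apply: eq_bigr => i _; rewrite ?row_mxEl ?row_mxEr.
Qed.

Lemma dotv_base (c : 'rV_d) (z : 'rV_1) a :
  dotv (row_mx c z) (V (base a)) = d%:R * c 0 a.
Proof.
rewrite /V -[lshift 2 a]/(unsplit (inl _ a)) unsplitK dotv_row_mx.
rewrite [dotv z 0]big1 ?addr0 => [|i _]; last by rewrite mxE mulr0.
rewrite /dotv (bigD1 a) //= big1 => [|j /negPf ja]; rewrite !mxE ?eqxx /=.
  by rewrite mulr1 addr0 mulrC.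
by rewrite ja !mulr0.
Qed.

Lemma dotv_apex (c : 'rV_d) (z : 'rV_1) s :
  dotv (row_mx c z) (V (apex s)) = \sum_a c 0 a + z 0 0 * apex_height s.
Proof.
rewrite /V -[rshift d s]/(unsplit (inr _ s)) unsplitK dotv_row_mx; congr (_ + _).
  by apply: eq_bigr => a _; rewrite mxE mulr1.
by rewrite /dotv big_ord1 mxE.
Qed.

Lemma cval_barycenter (g : 'cV[R]_(1 + (d + 1))) :
  d%:R * (cval W g (apex 0) + cval W g (apex 1)) =
  2%:R * \sum_a cval W g (base a).
Proof.
have [c [b ->]] := affine_funP g; rewrite -[c]hsubmxK !cval_affine_fun !dotv_apex.
rewrite [in RHS](eq_bigr (fun a => b - d%:R * lsubmx c 0 a)) => [|a _]; last first.
  by rewrite cval_affine_fun dotv_base.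
rewrite sumrB sumr_const card_ord -mulr_sumr /apex_height /= -[b *+ d]mulr_natl.
ring.
Qed.

(** Such a face contains the common barycenter of the base and of the two apices, so its functional,
    being nonnegative, vanishes at every vertex. *)
Lemma bipyramid_faceT S : cone_face W S ->
  (forall a, base a \in S) \/ (forall s, apex s \in S) -> S = [set: I].
Proof.
move=> [g supS] full; have bary := cval_barycenter g.
have ge0 i : 0 <= cval W g i by case: (supS i).
have d0 : 0 < d%:R :> R by rewrite ltr0n.
have sum0 : \sum_a cval W g (base a) = 0 /\
    cval W g (apex 0) + cval W g (apex 1) = 0.
  case: full => all_in; split.
  - by apply: big1 => a _; apply: supports_eq0 supS _.
  - have : d%:R * (cval W g (apex 0) + cval W g (apex 1)) == 0.
      by rewrite bary big1 ?mulr0 // => a _; apply: supports_eq0 supS _.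
    by rewrite mulf_eq0 gt_eqF //= => /eqP.
  - have : 2%:R * \sum_a cval W g (base a) == 0.
      by rewrite -bary !(supports_eq0 supS) // addr0 mulr0.
    by rewrite mulf_eq0 pnatr_eq0 /= => /eqP.
  - by rewrite !(supports_eq0 supS) // addr0.
have [sb /eqP] := sum0; rewrite paddr_eq0 // => /andP[a0 a1].
apply/setP=> i; rewrite inE; have [_ ->] := supS i.
case: (split_ordP i) => [a ->|s ->].
  move/eqP: sb; rewrite psumr_eq0 // => /allP/(_ a).
  by rewrite mem_index_enum => /(_ isT).
by have /orP[/eqP ->|/eqP ->] : (s == 0) || (s == 1) by case: s => [[|[|]]].
Qed.

(** The functional sums the coordinates of the base vertices outside [S]. It takes the same value
    [E] at both apices, positive because of [a0]; the last coordinate, scaled by [E * z], then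
    brings it to zero at the apex in [S], if any. *)
Lemma bipyramid_face S a0 : base a0 \notin S ->
  ~~ ((apex 0 \in S) && (apex 1 \in S)) -> cone_face W S.
Proof.
move=> a0S not_both; pose e : 'rV[R]_d := \row_a - (base a \notin S)%:R.
pose E : R := \sum_a (base a \notin S)%:R.
have E_gt0 : 0 < E.
  by rewrite /E (bigD1 a0) //= a0S ltr_pwDl ?ltr01 // sumr_ge0 // => a _; rewrite ler0n.
pose z : R := if apex 0 \in S then 1 else if apex 1 \in S then -1 else 0.
exists (affine_fun (row_mx e (const_mx (E * z))) 0) => i; rewrite cval_affine_fun.
case: (split_ordP i) => [a ->|s ->].
  rewrite dotv_base mxE mulrN opprK add0r mulr_ge0 ?ler0n //.
  by rewrite mulf_eq0 !pnatr_eq0 eqb0 negbK gtn_eqF.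
have -> : 0 - dotv (row_mx e (const_mx (E * z))) (V (apex s)) =
    E * (1 - z * apex_height s).
  rewrite dotv_apex mxE (eq_bigr (fun a => - (base a \notin S)%:R)) => [|a _].
    by rewrite sumrN -/E; ring.
  by rewrite mxE.
have E0 := gt_eqF E_gt0; rewrite pmulr_rge0 // mulf_eq0 E0 /= /z /apex_height.
have /orP[/eqP ->|/eqP ->] : (s == 0) || (s == 1) by case: s => [[|[|]]].
  by move: not_both; case: (apex 0 \in S); case: (apex 1 \in S) => //= _;
    split; try (by apply/esym/eqP; lra); try (by apply/esym/gt_eqF; lra); lra.
by move: not_both; case: (apex 0 \in S); case: (apex 1 \in S) => //= _;
  split; try (by apply/esym/eqP; lra); try (by apply/esym/gt_eqF; lra); lra.
Qed.

Lemma bipyramid_face_rank S a0 : base a0 \notin S ->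
  ~~ ((apex 0 \in S) && (apex 1 \in S)) -> cone_rank W S = #|S|.
Proof.
move=> a0S not_both; apply: cone_rank_simplex => T /subsetP TS.
apply: (@bipyramid_face T a0); first by apply: contra a0S; apply: TS.
by apply: contra not_both => /andP[/TS -> /TS ->].
Qed.

Definition base_set : {set I} := [set base a | a : 'I_d].

Lemma card_base_set : #|base_set| = d.
Proof. by rewrite card_imset ?card_ord //; apply: lshift_inj. Qed.

Lemma apex_base_set s : apex s \notin base_set.
Proof.
by apply/imsetP=> -[a _ /(congr1 val)/= sE]; have := ltn_ord a; rewrite -sE; lia.
Qed.

Lemma base_in_set a : base a \in base_set.
Proof. exact: imset_f. Qed.

Lemma bipyramid_rankT : cone_rank W [set: I] = d.+1.
Proof.
pose a0 : 'I_d := Ordinal d_gt0; pose S := apex 0 |: (base_set :\ base a0).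
have cS : #|S| = d.
  rewrite cardsU1 !inE (negbTE (apex_base_set 0)) andbF /=.
  by have := cardsD1 (base a0) base_set; rewrite base_in_set card_base_set => /esym.
have a0S : base a0 \notin S by rewrite !inE eqxx /= orbF eq_lrshift.
have not_both : ~~ ((apex 0 \in S) && (apex 1 \in S)).
  by rewrite !inE (negbTE (apex_base_set 1)) andbF orbF [apex 1 == _]eq_rshift andbF.
apply/eqP; rewrite eqn_leq; apply/andP; split; last first.
  rewrite -[X in (X < _)%N]cS -(bipyramid_face_rank a0S not_both).
  apply: cone_rank_lt; first exact: bipyramid_face a0S not_both.
  by rewrite properT; apply: contraNneq a0S => ->; rewrite inE.
(* All vertices lie in the hyperplane where the first [d] coordinates sum to [d], which lowers the
   rank from [d + 2] to at most [d.+1]. *)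
pose u : 'cV[R]_(1 + (d + 1)) := affine_fun (row_mx (const_mx 1) 0) d%:R.
have spanu : cone_span W [set: I] *m u = 0.
  apply: cone_span_mul => i _; rewrite cval_affine_fun.
  case: (split_ordP i) => [a ->|s ->].
    by rewrite dotv_base mxE mulr1 subrr.
  rewrite dotv_apex [X in X * _]mxE mul0r addr0.
  by rewrite (eq_bigr (fun=> 1)) => [|a _]; rewrite ?mxE // sumr_const card_ord subrr.
have ru : (0 < \rank u)%N.
  rewrite lt0n mxrank_eq0; apply/eqP=> /matrixP/(_ (lshift _ 0) 0).
  rewrite /u /affine_fun col_mxEu !mxE eqxx mulr1n => /eqP.
  by rewrite pnatr_eq0 gtn_eqF.
rewrite -ltnS; apply: leq_trans (leq_trans (mulmx0_rank_max spanu) _).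
  by rewrite -addn1 leq_add2l.
by rewrite add1n addn1.
Qed.

Lemma affdim_bipyramid : affdim (conv V) d.
Proof. by rewrite conv_hull; apply: cone_rank_affdim; apply: bipyramid_rankT. Qed.

Lemma ridge_without_apex S : cone_face W S -> cone_rank W S = d.-1 ->
  (forall s, apex s \notin S) -> exists a, S = base_set :\ base a.
Proof.
move=> fS rS no_apex.
have sub : S \subset base_set.
  apply/subsetP=> i; case: (split_ordP i) => [a -> _|s -> sS].
    exact: base_in_set.
  by have := no_apex s; rewrite sS.
have [a aS] : exists a, base a \notin S.
  apply/existsP; apply: contraT; rewrite negb_exists => /forallP all_in.
  have ST : S = [set: I].
    by apply: bipyramid_faceT fS _; left=> a; have := all_in a; rewrite negbK.
  by have := no_apex 0; rewrite ST inE.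
exists a; apply/eqP; rewrite eqEcard; apply/andP; split.
  apply/subsetP=> i iS; rewrite !inE (subsetP sub) // andbT.
  by apply: contraNneq aS => <-.
have := cone_rank_le_card W S; rewrite rS; apply: leq_trans.
have := cardsD1 (base a) base_set; rewrite base_in_set card_base_set => dE.
by rewrite -ltnS prednK // [X in (_ <= X)%N]dE.
Qed.

Lemma ridge_with_apex a0 a1 s : a0 != a1 ->
  let S := apex s |: (base_set :\ base a0 :\ base a1) in
  cone_face W S /\ cone_rank W S = d.-1.
Proof.
move=> na01 S.
have a0S : base a0 \notin S by rewrite !inE eq_lrshift eqxx andbF.
have not_both : ~~ ((apex 0 \in S) && (apex 1 \in S)).
  rewrite !inE !(negbTE (apex_base_set _)) !andbF !orbF !eq_rshift.
  by case: s {S a0S} => [[|[|]]].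
split; first exact: bipyramid_face a0S not_both.
rewrite (bipyramid_face_rank a0S not_both) cardsU1 !inE.
rewrite (negbTE (apex_base_set s)) !andbF /=.
have c0 := cardsD1 (base a0) base_set; rewrite base_in_set card_base_set in c0.
have c1 := cardsD1 (base a1) (base_set :\ base a0).
rewrite !inE eq_lshift eq_sym na01 base_in_set /= in c1.
by rewrite -c1; apply/eqP; rewrite -eqSS prednK // [X in _ == X]c0.
Qed.

(** Every ridge on the path contains [apex 0]: the facet joining such a ridge to the next one cannot
    contain [apex 1], and a next ridge with neither apex would be one of the deleted ridges in the
    base. *)
Lemma bipyramid_connected_le k m : d = k.+2 ->
  m_connected (kface (conv V) k) (kadj (conv V) k) m -> (m <= d)%N.
Proof.
move=> dE [_ conn]; rewrite leqNgt; apply/negP=> lt_m.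
have [k1 k2] : d.-1 = k.+1 /\ d.+1 = k.+3 by rewrite dE.
have [a0 [a1 na01]] : exists a0 a1 : 'I_d, a0 != a1.
  have d1 : (1 < d)%N by rewrite dE.
  by exists (Ordinal d_gt0), (Ordinal d1).
pose A s := apex s |: (base_set :\ base a0 :\ base a1).
have [fA rA] : (forall s, cone_face W (A s)) /\ forall s, cone_rank W (A s) = k.+1.
  by rewrite -k1; split=> s; have [] := ridge_with_apex s na01.
have base_face a : cone_face W (base_set :\ base a).
  apply: (@bipyramid_face _ a); first by rewrite !inE eqxx.
  by rewrite !inE (negbTE (apex_base_set _)) andbF.
have kA s : kface (conv V) k (hull V (A s)) by apply/kface_hullP; exists (A s).
have sA s a : hull V (base_set :\ base a) <> hull V (A s).
  move=> /(hull_inj (base_face a) (fA s))/setP/(_ (apex s)).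
  by rewrite setU11 !inE (negbTE (apex_base_set _)) andbF.
have [|n [p [p0 [pn [pV pE]]]]] := conn d (fun a => hull V (base_set :\ base a))
  _ _ _ (kA 0) (kA 1) (sA 0) (sA 1); first by lia.
have top i : (i <= n)%N -> exists S, [/\ cone_face W S, apex 0 \in S & p i = hull V S].
  elim: i => [_|i IHi lt_i]; first by exists (A 0); rewrite setU11.
  have [S [fS top_S pS]] := IHi (ltnW lt_i).
  have [_ [/kface_hullP[S' [fS' rS' pS']]
      [_ [H [/kface_hullP[K [fK rK ->]] [SK S'K]]]]]] :=
    pE i lt_i.
  have {}SK : S \subset K by apply: hull_subset fK _ => x xS; apply: SK; rewrite pS.
  have {}S'K : S' \subset K.
    by apply: hull_subset fK _ => x xS'; apply: S'K; rewrite pS'.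
  have bot_K : apex 1 \notin K.
    apply/negP=> bot_K; have KT : K = [set: I].
      apply: bipyramid_faceT fK _; right=> s.
      have /orP[/eqP ->|/eqP -> //] : (s == 0) || (s == 1) by case: s => [[|[|]]].
      exact: subsetP SK _ top_S.
    by move: rK; rewrite KT bipyramid_rankT k2; apply/eqP; rewrite !eqSS gtn_eqF.
  exists S'; split=> //; apply: contraT => top_S'.
  have [||a S'E] := ridge_without_apex fS'; first by rewrite k1.
    move=> s; have /orP[/eqP -> //|/eqP ->] : (s == 0) || (s == 1).
      by case: s => [[|[|]]].
    by apply: contra bot_K; apply: (subsetP S'K).
  by have [_ /(_ a)] := pV i.+1 lt_i; rewrite pS' S'E.
have [S [fS top_S]] := top n (leqnn n); rewrite pn => /hull_inj AS.
move: top_S; rewrite -AS // !inE (negbTE (apex_base_set _)) !andbF orbF.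
by rewrite eq_rshift.
Qed.
End Bipyramid.

Theorem theorem1p1 (R : realType) (k d : nat) :
  (k <= d - 1)%N -> (0 < d)%N ->
  let mkd := if k.+2 == d then d else (k.+1 * (d - k))%N in
  all_Gk_connected R k d mkd /\
  (forall m : nat, (0 < m)%N -> all_Gk_connected R k d m -> (m <= mkd)%N).
Proof.
move=> le_kd d_gt0 mkd; have lt_kd : (k < d)%N by lia.
split=> [N P [n [V ->]] dimP|m _ conn]; first exact: Gk_connected.
rewrite /mkd; case: eqP => [dE|nd].
  have bip := conn _ _ (ex_intro _ _ (ex_intro _ _ erefl)) (affdim_bipyramid R d_gt0).
  exact (bipyramid_connected_le d_gt0 (esym dE) bip).
have simplex := conn _ _ (ex_intro _ _ (ex_intro _ _ erefl)) (affdim_simplex R d).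
have [k0|k_gt0] := posnP k.
  by have := simplex_connected_bin simplex; rewrite k0 bin1; lia.
have [k3|k3] := leqP k.+3 d; first exact: simplex_connected_mul simplex.
have dE : d = k.+1 by lia.
have := simplex_connected_bin simplex; rewrite dE binSn subSnn muln1; lia.
Qed.
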